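(* For any fixed variable configuration with $6$ or $7$ lines, the number of its occurrences in a Steiner triple system of order $v$ can be computed in time $O(v^4)$.
   Context: A Steiner triple system of order $v$, STS$(v)$, is a pair $(V,\mathcal{B})$ with $|V|=v$ and $\mathcal{B}$ a set of 3-subsets (lines) of $V$ such that every 2-subset of $V$ lies in exactly one line. A configuration in it is a subset $\mathcal{B}'\subseteq\mathcal{B}$ together with the union of its lines as point set; an $n$-line configuration has $n$ lines. The number of occurrences of a configuration $C$ in an STS is the number of subsets $\mathcal{B}'\subseteq\mathcal{B}$whose configuration is isomorphic to $C$. A configuration is constant if its number of occurrences in an STS$(v)$ depends only on $v$, and variable otherwise. The STS is the input. *)

(* Defs.v *)
From mathcomp Require Import all_boot.

Set Implicit Arguments.
Unset Strict Implicit.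
Unset Printing Implicit Defensive.

(** * Steiner triple systems and configurations *)

(* The point set is the whole finite type [V], the order is [#|V|]. *)
Definition steiner_triple_system (V : finType) (B : {set {set V}}) : Prop :=
  (forall l : {set V}, l \in B -> #|l| = 3) /\
  (forall p : {set V}, #|p| = 2 -> #|[set l in B | p \subset l]| = 1).

(* A configuration is given by its set of lines; its point set is [cover C].
   Only the values of [f] on [cover C] matter. *)
Definition config_iso (T V : finType)
    (C : {set {set T}}) (D : {set {set V}}) : bool :=
  [exists f : {ffun T -> V},
     [forall x in cover C, forall y in cover C, (f x == f y) ==> (x == y)] &&
     ([set [set f x | x in l] | l : {set T} in C] == D)].

Definition occurrences (T V : finType)
    (C : {set {set T}}) (B : {set {set V}}) : nat :=
  #|[set D : {set {set V}} | (D \subset B) && config_iso C D]|.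

Definition constant_config (T : finType) (C : {set {set T}}) : Prop :=
  forall (V1 V2 : finType) (B1 : {set {set V1}}) (B2 : {set {set V2}}),
    steiner_triple_system B1 -> steiner_triple_system B2 ->
    #|V1| = #|V2| -> occurrences C B1 = occurrences C B2.

Definition variable_config (T : finType) (C : {set {set T}}) : Prop :=
  ~ constant_config C.

(** * The word RAM

  Memory is an array of words, that is, of numbers smaller than a modulus [M],
  indexed by words; programs are in structured form.  Every node of an
  expression (literal, memory access, arithmetic operation or comparison),
  every store and every conditional jump takes one unit of time.  Arithmetic is
  modulo [M], so that values cannot grow beyond the word size. *)

Inductive binop := OAdd | OSub | OMul | ODiv | OLt | OEq.

Inductive expr :=
| Const of nat
| Read of expr
| Op of binop & expr & expr.

Inductive cmd :=
| Skip
| Write of expr & expr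
| Seq of cmd & cmd
| If of expr & cmd & cmd
| While of expr & cmd.

Definition memory := nat -> nat.

Definition update (m : memory) (a x : nat) : memory :=
  fun i => if i == a then x else m i.

(* [OLt] and [OEq] return 1 for true and 0 for false. *)
Definition binop_eval (M : nat) (o : binop) (x y : nat) : nat :=
  match o with
  | OAdd => (x + y) %% M
  | OSub => (x + M - y) %% M
  | OMul => (x * y) %% M
  | ODiv => (x %/ y) %% M
  | OLt => (x < y) %% M
  | OEq => (x == y) %% M
  end.

Fixpoint eval (M : nat) (m : memory) (e : expr) : nat :=
  match e with
  | Const n => n %% M
  | Read e1 => m (eval M m e1)
  | Op o e1 e2 => binop_eval M o (eval M m e1) (eval M m e2)
  end.

Fixpoint cost (e : expr) : nat :=
  match e with
  | Const _ => 1
  | Read e1 => (cost e1).+1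
  | Op _ e1 e2 => (cost e1 + cost e2).+1
  end.

(* [exec M c m t m']: started in memory [m], the program [c] halts after [t]
   units of time in memory [m'].  A condition is true when it is nonzero. *)
Inductive exec (M : nat) : cmd -> memory -> nat -> memory -> Prop :=
| ExecSkip m : exec M Skip m 1 m
| ExecWrite a e m :
    exec M (Write a e) m (cost a + cost e).+1
         (update m (eval M m a) (eval M m e))
| ExecSeq c1 c2 m1 m2 m3 t1 t2 :
    exec M c1 m1 t1 m2 -> exec M c2 m2 t2 m3 ->
    exec M (Seq c1 c2) m1 (t1 + t2) m3
| ExecIfTrue e c1 c2 m m' t :
    eval M m e != 0 -> exec M c1 m t m' ->
    exec M (If e c1 c2) m (cost e + t).+1 m'
| ExecIfFalse e c1 c2 m m' t :
    eval M m e = 0 -> exec M c2 m t m' ->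
    exec M (If e c1 c2) m (cost e + t).+1 m'
| ExecWhileTrue e c m1 m2 m3 t1 t2 :
    eval M m1 e != 0 -> exec M c m1 t1 m2 -> exec M (While e c) m2 t2 m3 ->
    exec M (While e c) m1 (cost e + t1 + t2).+1 m3
| ExecWhileFalse e c m :
    eval M m e = 0 -> exec M (While e c) m (cost e).+1 m.

Lemma exec_det M c m t1 m1 t2 m2 :
  exec M c m t1 m1 -> exec M c m t2 m2 -> t1 = t2 /\ m1 = m2.
Proof.
move=> H; elim: H t2 m2 => {c m t1 m1}.
- by move=> m t2 m2 H; inversion H.
- by move=> a e m t2 m2 H; inversion H.
- move=> c1 c2 m1 m2 m3 t1 t2 _ IH1 _ IH2 t m H; inversion H; subst.
  have [E1 E2] := IH1 _ _ ltac:(eassumption); subst.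
  by have [-> ->] := IH2 _ _ ltac:(eassumption).
- move=> e c1 c2 m m' t E _ IH t2 m2 H; inversion H; subst.
    by have [-> ->] := IH _ _ ltac:(eassumption).
  by move/eqP: E.
- move=> e c1 c2 m m' t E _ IH t2 m2 H; inversion H; subst.
    by rewrite E in H6.
  by have [-> ->] := IH _ _ ltac:(eassumption).
- move=> e c m1 m2 m3 t1 t2 E _ IH1 _ IH2 t m H; inversion H; subst.
    have [E1 E2] := IH1 _ _ ltac:(eassumption); subst.
    by have [-> ->] := IH2 _ _ ltac:(eassumption).
  by move/eqP: E.
- move=> e c m E t2 m2 H; inversion H; subst => //.
  by rewrite E in H2.
Qed.

(** * Computing with a Steiner triple system as input *)

(* Words of [k * ceil (log2 (v + 2))] bits. *)
Definition word_modulus (k v : nat) : nat := 2 ^ (k * up_log 2 v.+2).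

(* The points are 0, ..., v - 1; each line is listed exactly once, the order
   of the lines and of the points in a line being arbitrary. *)
Definition lists_lines (v : nat) (s : seq ('I_v * 'I_v * 'I_v))
    (B : {set {set 'I_v}}) : Prop :=
  perm_eq [seq [set t.1.1; t.1.2; t.2] | t <- s] (enum B).

(* The input words: v, the number of lines, the points of the lines. *)
Definition input_words (v : nat) (s : seq ('I_v * 'I_v * 'I_v)) : seq nat :=
  v :: size s ::
  flatten [seq [:: nat_of_ord t.1.1; nat_of_ord t.1.2; nat_of_ord t.2] | t <- s].

Definition initial_memory (M : nat) (w : seq nat) : memory :=
  fun i => nth 0 w i %% M.

(* One program and one constant [k] for the word size serve all systems; the
   result is returned in cell 0. *)
Definition sts_computable_in_time_O
    (F : forall v : nat, {set {set 'I_v}} -> nat) (g : nat -> nat) : Prop :=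
  exists (P : cmd) (k c N : nat),
  forall (v : nat) (B : {set {set 'I_v}}) (s : seq ('I_v * 'I_v * 'I_v)),
    steiner_triple_system B -> lists_lines s B ->
    exists (t : nat) (m : memory),
      [/\ exec (word_modulus k v) P
               (initial_memory (word_modulus k v) (input_words s)) t m,
          m 0 = F v B
        & N <= v -> t <= c * g v].

(* Main.v *)
Require Import Defs.
From mathcomp Require Import all_boot zify.

Set Implicit Arguments.
Unset Strict Implicit.
Unset Printing Implicit Defensive.

(** Occurrences of [C] times automorphisms of [C] is the number of embeddings
  of [C], i.e. of injective maps of its points sending lines to lines.  Let [x]
  be a point of degree at most 1.  An embedding of [C] without [x] extends to
  [x] freely (degree 0) or in one forced way (degree 1), unless the new value is
  already taken by a point [y]; in degree 1 that failure is again an embedding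
  of a configuration, with one point less, where [y] replaces [x] on its line.
  So the count reduces, with coefficients polynomial in [v], to full
  configurations, in which every point has degree at least 2.

  A full configuration with at most 7 lines has at most 10 points and is
  generated by at most 4 of them under "two points of a line determine the
  third": four nested loops over a table of third points count its embeddings.
  Indeed, each new generator can be taken on a line meeting the closed set
  generated so far, and so adds two points; four generators give at least 7
  points, and a proper closed set misses at least 3.  In the extremal case
  10 = 7 + 3 the three missed points span a triangle, whose closure already
  has 6 points, and a fourth generator brings this to 8 > 7. *)

(** * Iterated sums over assignments *)

Section IteratedSums.
Variables (T : finType) (v : nat).
Implicit Types (e : T -> nat) (P Q : (T -> nat) -> nat) (x y : T) (xs ys : seq T).

Definition assign e x a : T -> nat := fun y => if y == x then a else e y.

(** Written as nested sums rather than as one sum over finite functions, so that a point can be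
    split off and the sum can be matched with nested loops. Points outside [xs] keep their value
    under [e]. *)
Fixpoint isum xs P e : nat :=
  if xs is x :: xs' then \sum_(a < v) isum xs' P (assign e x a) else P e.

Lemma eq_isum xs P Q e :
  (forall e', (forall y, y \in xs -> e' y < v) ->
              (forall y, y \notin xs -> e' y = e y) -> P e' = Q e') ->
  isum xs P e = isum xs Q e.
Proof.
elim: xs e => [|x xs IH] e H /=; first by apply: H.
apply: eq_bigr => a _; apply: IH => e' lt_e' eq_e'; apply: H => y.
  rewrite inE => /predU1P[->|]; last exact: lt_e'.
  case: (boolP (x \in xs)) => [/lt_e'//|/eq_e' ->].
  by rewrite /assign eqxx.
rewrite inE negb_or => /andP[nyx /eq_e' ->].
by rewrite /assign (negPf nyx).
Qed.

(** Different orders of assignment yield functions that agree only pointwise; a summand that reads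
    just the points of [D] does not see the difference. *)
Lemma isum_local (D : {set T}) xs P e e' :
  (forall e1 e2, {in D, e1 =1 e2} -> P e1 = P e2) ->
  (forall y, y \in D -> y \notin xs -> e y = e' y) ->
  isum xs P e = isum xs P e'.
Proof.
move=> locP; elim: xs e e' => [|x xs IH] e e' H /=.
  by apply: locP => y yD; apply: H.
apply: eq_bigr => a _; apply: IH => y yD nyxs; rewrite /assign.
by case: eqP => // /eqP nyx; apply: H; rewrite // inE negb_or nyx.
Qed.

Lemma isum_swap (D : {set T}) x y xs P e :
  (forall e1 e2, {in D, e1 =1 e2} -> P e1 = P e2) -> x != y ->
  isum [:: x, y & xs] P e = isum [:: y, x & xs] P e.
Proof.
move=> locP nxy /=; rewrite exchange_big /=.
apply: eq_bigr => a _; apply: eq_bigr => b _; apply: isum_local locP _ => z _ _.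
by rewrite /assign; case: (z =P y) => // ->; rewrite eq_sym (negPf nxy).
Qed.

Lemma isum_perm (D : {set T}) xs ys P e :
  (forall e1 e2, {in D, e1 =1 e2} -> P e1 = P e2) ->
  uniq xs -> perm_eq xs ys -> isum xs P e = isum ys P e.
Proof.
move=> locP.
(* Adjacent swaps bring any point of the list to the front, which lets the induction match the heads
   of the two lists. *)
have to_front x zs e0 : x \in zs -> uniq zs ->
    isum zs P e0 = isum (x :: rem x zs) P e0.
  elim: zs e0 => // z zs IH e0; rewrite inE => xzs /= /andP[nz uz].
  case: (z =P x) xzs => [-> //|/eqP nzx]; rewrite eq_sym (negPf nzx) /= => xzs.
  rewrite -[RHS](isum_swap _ _ locP nzx) /=.
  by apply: eq_bigr => a _; rewrite IH.
elim: xs ys e => [|x xs IH] ys e uxs pxy.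
  by rewrite (perm_nilP (_ : perm_eq ys [::])) // perm_sym.
have uys : uniq ys by rewrite -(perm_uniq pxy).
have xys : x \in ys by rewrite -(perm_mem pxy) mem_head.
rewrite (to_front x ys e xys uys) /=; apply: eq_bigr => a _; apply: IH.
  by case/andP: uxs.
by rewrite -(perm_cons x) (perm_trans pxy) // perm_to_rem.
Qed.

Lemma isum_rcons xs x P e :
  isum (rcons xs x) P e = isum xs (fun e' => \sum_(a < v) P (assign e' x a)) e.
Proof. by elim: xs e => //= y xs IH e; apply: eq_bigr. Qed.

Lemma isum_const0 xs e : isum xs (fun _ => 0) e = 0.
Proof. by elim: xs e => //= x xs IH e; rewrite big1. Qed.

Lemma isumD xs P Q e :
  isum xs (fun e' => P e' + Q e') e = isum xs P e + isum xs Q e.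
Proof.
by elim: xs e => //= x xs IH e; rewrite -big_split; apply: eq_bigr.
Qed.

Lemma isum_sum (I : Type) (r : seq I) (p : pred I) xs (F : I -> (T -> nat) -> nat) e :
  isum xs (fun e' => \sum_(i <- r | p i) F i e') e
  = \sum_(i <- r | p i) isum xs (F i) e.
Proof.
elim: xs e => //= x xs IH e; rewrite exchange_big /=.
by apply: eq_bigr.
Qed.

Lemma isumMl xs n P e : isum xs (fun e' => n * P e') e = n * isum xs P e.
Proof.
by elim: xs e => //= x xs IH e; rewrite big_distrr; apply: eq_bigr.
Qed.

Lemma isum_leq xs P e : (forall e', P e' <= 1) -> isum xs P e <= v ^ size xs.
Proof.
move=> leP; elim: xs e => [|x xs IH] e //=; rewrite expnS.
apply: leq_trans (_ : \sum_(a < v) v ^ size xs <= _); first exact: leq_sum.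
by rewrite sum_nat_const card_ord.
Qed.

(** Passes from nested sums to a sum over finite functions, the form in which embeddings can be
    grouped by their image. The induction splits the functions by their value at the first point. *)
Lemma isum_ffun xs P e :
  (forall e1 e2, e1 =1 e2 -> P e1 = P e2) ->
  uniq xs -> (forall y, y \notin xs -> e y < v) ->
  isum xs P e
  = \sum_(f : {ffun T -> 'I_v} | [forall y, (y \notin xs) ==> (f y == e y :> nat)])
      P (fun y => f y).
Proof.
move=> extP; elim: xs e => [|x xs IH] e /=.
  move=> _ lt_e; have lt_e' y : e y < v by apply: lt_e.
  rewrite (big_pred1 [ffun y => Ordinal (lt_e' y)]); last first.
    move=> f /=; apply/forallP/eqP => [H|-> y]; last by rewrite ffunE.
    by apply/ffunP=> y; apply/val_inj; rewrite ffunE /=; apply/eqP/H.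
  by apply: extP => y; rewrite ffunE.
case/andP=> nx uxs lt_e.
rewrite (partition_big (fun f : {ffun T -> 'I_v} => f x) xpredT) //=.
apply: eq_bigr => a _; rewrite IH //; last first.
  move=> y nyxs; rewrite /assign; case: eqP => // /eqP nyx.
  by apply: lt_e; rewrite inE negb_or nyx.
apply: eq_bigl => f; apply/forallP/andP => [H|[/forallP H /eqP fx] y].
  split.
    apply/forallP => y; apply/implyP; rewrite inE negb_or => /andP[nyx nyxs].
    by have:= H y; rewrite nyxs /assign (negPf nyx).
  by have:= H x; rewrite nx /assign eqxx.
apply/implyP => nyxs; rewrite /assign; case: (y =P x) => [->|/eqP nyx].
  by rewrite fx.
by have:= H y; rewrite inE negb_or nyx nyxs.
Qed.

End IteratedSums.

(** * Counting embeddings of a configuration *)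

(* [t a b] is the third point of the line through [a] and [b]; [t a a] may be
   any point. *)
Record sts_op (v : nat) (t : nat -> nat -> nat) : Prop := StsOp {
  op_lt : forall a b, a < v -> b < v -> t a b < v;
  op_sym : forall a b, a < v -> b < v -> t a b = t b a;
  op_neq : forall a b, a < v -> b < v -> a != b -> t a b != a;
  op_inv : forall a b, a < v -> b < v -> a != b -> t a (t a b) = b }.

Section Embeddings.
Variable T : finType.
Implicit Types (X l : {set T}) (L : {set {set T}}) (e : T -> nat).

(** Lines are unordered sets, so the equation is asked for every ordering of the three points. *)
Definition line_ok (t : nat -> nat -> nat) e l : bool :=
  [forall a in l, forall b in l, forall c in l,
     [&& a != b, a != c & b != c] ==> (t (e a) (e b) == e c)].

Definition embeds (t : nat -> nat -> nat) X L e : bool :=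
  [forall x in X, forall y in X, (e x == e y) ==> (x == y)] &&
  [forall l in L, line_ok t e l].

(** The start value 0 is a dummy for the points outside [X], which [embeds] does not read when the
    lines lie in [X]. *)
Definition embeddings X L (v : nat) (t : nat -> nat -> nat) : nat :=
  isum v (enum X) (fun e => embeds t X L e : nat) (fun _ => 0).

Definition triples_on X L : Prop :=
  forall l, l \in L -> #|l| = 3 /\ l \subset X.

Definition linear L : Prop :=
  forall l1 l2 x y, l1 \in L -> l2 \in L -> x != y ->
    x \in l1 -> y \in l1 -> x \in l2 -> y \in l2 -> l1 = l2.

Lemma line_okP t e l :
  reflect (forall a b c, a \in l -> b \in l -> c \in l ->
             a != b -> a != c -> b != c -> t (e a) (e b) = e c)
          (line_ok t e l).
Proof.
apply: (iffP forall_inP) => [H a b c al bl cl ab ac bc | H a al].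
  by have /forall_inP/(_ b bl)/forall_inP/(_ c cl) := H a al;
     rewrite ab ac bc => /eqP.
apply/forall_inP => b bl; apply/forall_inP => c cl.
by apply/implyP => /and3P[ab ac bc]; apply/eqP/H.
Qed.

Lemma embedsP t X L e :
  reflect ((forall x y, x \in X -> y \in X -> e x = e y -> x = y) /\
           (forall l, l \in L -> line_ok t e l))
          (embeds t X L e).
Proof.
apply: (iffP andP) => -[H1 H2]; split.
- move=> x y xX yX exy; apply/eqP.
  by have /forall_inP/(_ x xX)/forall_inP/(_ y yX)/implyP-> := H1; rewrite ?exy.
- by move/forall_inP: H2.
- apply/forall_inP => x xX; apply/forall_inP => y yX.
  by apply/implyP => /eqP/(H1 _ _ xX yX)/eqP.
- exact/forall_inP.
Qed.

Lemma embeds_local t X L e1 e2 : triples_on X L -> {in X, e1 =1 e2} ->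
  embeds t X L e1 = embeds t X L e2.
Proof.
move=> XL; have imp f g : {in X, f =1 g} -> embeds t X L f -> embeds t X L g.
  move=> E /embedsP[inj ok]; apply/embedsP; split=> [x y xX yX|l lL].
    by rewrite -!E //; apply: inj.
  have lX z : z \in l -> z \in X by apply/subsetP; case: (XL l lL).
  apply/line_okP => a b c al bl cl; rewrite -!E ?lX //.
  by move/line_okP: (ok l lL); apply.
by move=> E; apply/idP/idP; apply: imp => // x xX; rewrite E.
Qed.

(** Symmetry and the law [t a (t a b) = b] derive the equations for the other orderings from a
    single one. *)
Lemma line_ok3 v t e q r y : sts_op v t ->
  e q < v -> e r < v -> e y < v -> e q != e r -> e q != e y -> e r != e y ->
  line_ok t e [set q; r; y] = (t (e q) (e r) == e y).
Proof.
move=> St lq lr ly nqr nqy nry.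
have nqr' : q != r by apply: contraNneq nqr => ->.
have nqy' : q != y by apply: contraNneq nqy => ->.
have nry' : r != y by apply: contraNneq nry => ->.
apply/idP/eqP => [/line_okP/(_ q r y) H|E].
  by apply: H; rewrite // !inE eqxx ?orbT.
have E1 : t (e q) (e y) = e r by rewrite -E (op_inv St).
have E2 : t (e r) (e q) = e y by rewrite (op_sym St).
have E3 : t (e r) (e y) = e q by rewrite -E2 (op_inv St) // eq_sym.
have E4 : t (e y) (e q) = e r by rewrite (op_sym St).
have E5 : t (e y) (e r) = e q by rewrite (op_sym St).
apply/line_okP => a b c; rewrite !inE.
by case/orP=> [/orP[]|] /eqP->; case/orP=> [/orP[]|] /eqP->;
   case/orP=> [/orP[]|] /eqP->; rewrite ?eqxx.
Qed.

Lemma card3_split l x : #|l| = 3 -> x \in l ->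
  exists q r, [/\ q != r, q != x, r != x & l = [set q; r; x]].
Proof.
move=> l3 xl; have : #|l :\ x| = 2 by have := cardsD1 x l; rewrite l3 xl; lia.
move/eqP/cards2P => [q [r [nqr E]]]; exists q, r.
have : q \in l :\ x by rewrite E !inE eqxx.
have : r \in l :\ x by rewrite E !inE eqxx orbT.
rewrite !inE => /andP[nr _] /andP[nq _]; split=> //.
by rewrite -(setD1K xl) E setUC.
Qed.

Lemma card3_split2 l x y : #|l| = 3 -> x \in l -> y \in l -> x != y ->
  exists z, [/\ z != x, z != y & l = [set x; y; z]].
Proof.
move=> l3 xl yl nxy; have [q [r [nqr nq nr E]]] := card3_split l3 xl.
move: yl; rewrite E !inE (eq_sym y x) (negPf nxy) orbF => /orP[]/eqP Ey; subst.
  exists r; rewrite nr eq_sym nqr; split=> //.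
  by rewrite setUC setUA.
exists q; rewrite nq nqr; split=> //.
by rewrite setUC [[set q] :|: _]setUC setUA.
Qed.

(** The third points of both lines must be sent to [t (e x) (e y)], so injectivity identifies them
    and the lines coincide. *)
Lemma embeddings_nonlinear X L v t l1 l2 x y : triples_on X L ->
  l1 \in L -> l2 \in L -> l1 != l2 -> x != y ->
  x \in l1 -> y \in l1 -> x \in l2 -> y \in l2 -> embeddings X L v t = 0.
Proof.
move=> XL l1L l2L nl nxy x1 y1 x2 y2.
rewrite -(isum_const0 v (enum X) (fun _ => 0)); apply: eq_isum => e _ _.
apply/eqP; rewrite eqb0; apply/negP => /embedsP[inj ok].
have [c1 s1] := XL _ l1L; have [c2 s2] := XL _ l2L.
have [z1 [zx1 zy1 E1]] := card3_split2 c1 x1 y1 nxy.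
have [z2 [zx2 zy2 E2]] := card3_split2 c2 x2 y2 nxy.
have z1l : z1 \in l1 by rewrite E1 !inE eqxx orbT.
have z2l : z2 \in l2 by rewrite E2 !inE eqxx orbT.
have H1 : t (e x) (e y) = e z1.
  by move/line_okP: (ok _ l1L); apply; rewrite // eq_sym.
have H2 : t (e x) (e y) = e z2.
  by move/line_okP: (ok _ l2L); apply; rewrite // eq_sym.
have E : z1 = z2.
  by apply: inj; [exact: subsetP z1l|exact: subsetP z2l|rewrite -H1 -H2].
by move: nl; rewrite E1 E2 E eqxx.
Qed.

(** Makes [x] the innermost variable: the rest of the configuration is already placed when [x] gets
    its value. *)
Lemma embeddings_point X L v t x : triples_on X L -> x \in X ->
  embeddings X L v t =
  isum v (enum (X :\ x))
    (fun e => \sum_(a < v) (embeds t X L (assign e x a) : nat)) (fun _ => 0).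
Proof.
move=> XL xX; rewrite -(isum_rcons _ _ _ (fun e => embeds t X L e : nat)); apply: (@isum_perm _ _ X).
- by move=> e1 e2 E; rewrite (embeds_local _ XL E).
- exact: enum_uniq.
apply: uniq_perm; first exact: enum_uniq.
  by rewrite rcons_uniq enum_uniq mem_enum !inE eqxx.
move=> y; rewrite mem_rcons inE !mem_enum !inE.
by case: eqP => // ->; rewrite xX.
Qed.

Lemma sum_ord_eq v (w : nat) (F : nat -> nat) : w < v ->
  (forall a, a != w -> F a = 0) -> \sum_(a < v) F a = F w.
Proof.
move=> wv F0; rewrite (bigD1 (Ordinal wv)) //= big1 ?addn0 // => a na.
by apply: F0.
Qed.

(** Separates the condition on the rest, which does not involve [a], from the freshness of [a] and
    from the lines through [x]. *)
Lemma embeds_assign t X L e x a : x \in X -> triples_on X L ->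
  embeds t X L (assign e x a) =
  [&& embeds t (X :\ x) [set l in L | x \notin l] e,
      [forall y in X :\ x, e y != a] &
      [forall l in L, (x \in l) ==> line_ok t (assign e x a) l]].
Proof.
move=> xX XL; have old y : y != x -> assign e x a y = e y.
  by rewrite /assign => /negPf->.
have new : assign e x a x = a by rewrite /assign eqxx.
have ok l : x \notin l -> line_ok t (assign e x a) l = line_ok t e l.
  move=> nxl; have nx y : y \in l -> y != x by apply: contraTneq => ->.
  by apply/line_okP/line_okP => H b c d bl cl dl; have := H b c d bl cl dl;
     rewrite !old ?nx.
apply/embedsP/and3P => [[inj hom]|[/embedsP[inj hom] /forall_inP nea /forall_inP hx]].
  split.
  - apply/embedsP; split=> [y z|l].
      rewrite !inE => /andP[nyx yX] /andP[nzx zX] E.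
      by apply: inj; rewrite ?old.
    by rewrite inE => /andP[lL nxl]; rewrite -ok ?hom.
  - apply/forall_inP => y; rewrite !inE => /andP[nyx yX].
    apply: contraNneq nyx => E; apply/eqP/inj => //.
    by rewrite new; case: (y =P x) => [->//|/eqP nyx]; rewrite old.
  - by apply/forall_inP => l lL; apply/implyP => _; apply: hom.
split=> [y z yX zX|l lL].
  case: (y =P x) (z =P x) => [->|/eqP nyx] [->|/eqP nzx] //; rewrite ?new ?old //.
  - by move/esym/eqP; rewrite (negPf (nea z _)) // !inE nzx.
  - by move/eqP; rewrite (negPf (nea y _)) // !inE nyx.
  by apply: inj; rewrite !inE ?nyx ?nzx.
case: (boolP (x \in l)) => xl; first by apply: (implyP (hx l lL)).
by rewrite ok //; apply: hom; rewrite inE lL.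
Qed.

(** By injectivity at most one point holds the value [w]. This turns a failure of freshness into a
    sum over the points that may cause it. *)
Lemma embeds_notin_sum t X L e (w : nat) : embeds t X L e ->
  [forall y in X, e y != w] + \sum_(y in X) (e y == w) = 1.
Proof.
case/embedsP => inj _; case: (boolP [forall y in X, e y != w]) => [/forall_inP H|].
  by rewrite big1 // => y yX; rewrite (negPf (H y yX)).
rewrite negb_forall => /existsP[y]; rewrite negb_imply negbK => /andP[yX /eqP ew].
rewrite (bigD1 y) //= ew eqxx big1 // => z /andP[zX nzy].
apply/eqP; rewrite eqb0; apply: contraNneq nzy => ezw.
by apply/eqP/inj; rewrite ?ezw.
Qed.

(** Of the [v] values for [x], exactly [#|X :\ x|] are taken. The identity is additive to avoid
    truncated subtraction. *)
Lemma embeddings_degree0 X L v t x : sts_op v t -> triples_on X L -> x \in X ->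
  (forall l, l \in L -> x \notin l) ->
  embeddings X L v t + #|X :\ x| * embeddings (X :\ x) L v t
  = v * embeddings (X :\ x) L v t.
Proof.
move=> St XL xX deg0; rewrite (embeddings_point _ _ XL xX).
have EL : [set l in L | x \notin l] = L.
  by apply/setP => l; rewrite inE; case: (boolP (l \in L)) => // /deg0 ->.
rewrite -!isumMl -isumD; apply: eq_isum => e lt_e _.
have ok a : [forall l in L, (x \in l) ==> line_ok t (assign e x a) l].
  by apply/forall_inP => l /deg0 /negPf->.
under eq_bigr => a _ do rewrite embeds_assign // EL ok andbT.
case: (boolP (embeds t (X :\ x) L e)) => emb; last first.
  by rewrite !muln0 big1.
rewrite /= !muln1 -sum1_card.
(* Each point of the rest is counted at the one value that it occupies. *)
have -> : \sum_(y in X :\ x) 1 = \sum_(a < v) \sum_(y in X :\ x) (e y == a).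
  rewrite exchange_big; apply: eq_bigr => y yX /=.
  rewrite (sum_ord_eq (F := fun a => e y == a) (w := e y)) ?eqxx //.
    by apply: lt_e; rewrite mem_enum.
  by move=> a; rewrite eq_sym => /negPf->.
rewrite -big_split /= -[RHS]card_ord -sum1_card.
by apply: eq_bigr => a _; apply: embeds_notin_sum emb.
Qed.

(* The extension of an embedding of [X :\ x] to the point [x] of degree 1 is
   forced, and fails only if its value is already taken by some [y]. *)
Lemma embeddings_degree1 X L v t x q r : sts_op v t -> triples_on X L ->
  x \in X -> q != r -> q != x -> r != x -> [set q; r; x] \in L ->
  (forall l, l \in L -> x \in l -> l = [set q; r; x]) ->
  embeddings X L v t +
  \sum_(y <- enum (X :\ x :\ q :\ r))
    embeddings (X :\ x) ([set q; r; y] |: (L :\ [set q; r; x])) v t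
  = embeddings (X :\ x) (L :\ [set q; r; x]) v t.
Proof.
move=> St XL xX nqr nqx nrx l0L deg1; rewrite (embeddings_point _ _ XL xX).
have EL : [set l in L | x \notin l] = L :\ [set q; r; x].
  apply/setP => l; rewrite !inE andbC; case: (boolP (l \in L)) => lL; rewrite ?andbF //.
  rewrite !andbT; apply/idP/idP => [|nl]; first by apply: contraNneq => ->; rewrite !inE eqxx orbT.
  by apply: contraNN nl => /(deg1 _ lL)->.
have [_ /subsetP l0X] := XL _ l0L.
have qX : q \in X :\ x by rewrite !inE nqx l0X // !inE eqxx.
have rX : r \in X :\ x by rewrite !inE nrx l0X // !inE eqxx orbT.
rewrite -isum_sum -isumD; apply: eq_isum => e lt_e _.
have {}lt_e y : y \in X :\ x -> e y < v by move=> yX; apply: lt_e; rewrite mem_enum.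
under [X in X + _]eq_bigr => a _ do rewrite embeds_assign // EL.
(* If [e] does not embed the rest, every term vanishes, since the configurations with
   [[set q; r; y]] keep all the other lines. *)
case: (boolP (embeds t (X :\ x) _ e)) => [emb|nemb]; last first.
  rewrite big1 // big1 // => y _; apply/eqP; rewrite eqb0.
  apply: contraNN nemb => /embedsP[inj hom]; apply/embedsP; split=> // l lL.
  by apply: hom; rewrite inE lL orbT.
have /embedsP[inj hom] := emb.
have neqr : e q != e r by apply: contraNneq nqr => /inj->.
pose w := t (e q) (e r); have wv : w < v by apply: (op_lt St); apply: lt_e.
have nwq : w != e q by apply: (op_neq St); rewrite ?lt_e.
have nwr : w != e r by rewrite /w (op_sym St) ?lt_e // (op_neq St) ?lt_e // eq_sym.
(* Either the forced value [w] is free and [x] takes it, or exactly one point [y] already holds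
   it. *)
rewrite -[RHS](embeds_notin_sum w emb); congr (_ + _).
  rewrite (sum_ord_eq (w := w) (F := fun a : nat => true &&
     ([forall y in X :\ x, e y != a] && [forall l in L, (x \in l) ==> line_ok t (assign e x a) l]))) //=.
    case: (boolP [forall y in X :\ x, e y != w]) => // nw; apply/eqP; rewrite eqb1.
    apply/forall_inP => l lL; apply/implyP => xl; rewrite (deg1 l lL xl).
    by rewrite (line_ok3 St) /assign ?eqxx ?(negPf nqx) ?(negPf nrx) ?lt_e // eq_sym.
  move=> a naw; apply/eqP; rewrite eqb0 negb_and orbC.
  apply/orP; left; apply: contraNN naw => /forall_inP/(_ _ l0L).
  rewrite !inE eqxx orbT /= => /line_okP/(_ q r x).
  rewrite !inE !eqxx !orbT /assign eqxx (negPf nqx) (negPf nrx) => <- //.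
(* The value [w] differs from those of [q] and [r], so these two points may be left out of the sum
   over [y]. *)
rewrite big_enum /= [RHS](bigD1 r) //= [in RHS](bigD1 q) /=; last by rewrite qX.
rewrite ![e _ == w]eq_sym (negPf nwq) (negPf nwr) /= !add0n.
apply: eq_big => [y|y]; first by rewrite !inE -!andbA; do !bool_congr.
rewrite 2!in_setD1 => /and3P[nyr nyq yX]; congr nat_of_bool.
have ney z : z \in X :\ x -> z != y -> e z != e y.
  by move=> zX; apply: contraNneq => /inj->.
(* That [y] holds [w] says precisely that [[set q; r; y]] is sent to a line. *)
rewrite [RHS]eq_sym -[RHS](line_ok3 (e := e) (q := q) (r := r) (y := y) St) ?lt_e ?ney // 1?eq_sym //.
apply/embedsP/idP => [[_ H]|ok]; first by apply: H; rewrite !inE eqxx.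
by split=> // l; rewrite 2!inE => /orP[/eqP->//|]; apply: hom.
Qed.

End Embeddings.

(** * Generating full configurations *)

Section Generation.
Variable T : finType.
Implicit Types (X S K l : {set T}) (L : {set {set T}}) (x y : T).

(* A schedule lists the points in the order in which they receive values:
   [(x, None)] ranges freely, [(x, Some (a, b))] is forced by a line. *)
Definition step := (T * option (T * T))%type.

Definition step_ok L K (s : step) : bool :=
  (s.1 \notin K) &&
  (if s.2 is Some (a, b) then [&& a \in K, b \in K & [set a; b; s.1] \in L]
   else true).

Fixpoint schedule L K (st : seq step) : bool :=
  if st is s :: st' then step_ok L K s && schedule L (s.1 |: K) st' else true.

Definition free_steps (st : seq step) : nat := count (fun s => s.2 == None) st.

Definition generated L k S : Prop :=
  exists st, [/\ schedule L set0 st, [set x in map fst st] = S & free_steps st <= k].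

Definition closed_in L S : bool :=
  [forall l in L, (1 < #|l :&: S|) ==> (l \subset S)].

(** [schedule] recurses from the front, whereas generation appends points at the end. *)
Lemma schedule_rcons L K st s :
  schedule L K (rcons st s) =
  schedule L K st && step_ok L (K :|: [set x in map fst st]) s.
Proof.
elim: st K => [|s0 st IH] K /=.
  have -> : [set x in [::]] = set0 :> {set T} by apply/setP => x; rewrite !inE.
  by rewrite setU0 andbT.
rewrite IH andbA; congr (_ && step_ok L _ s).
by apply/setP => x; rewrite !inE orbCA orbA.
Qed.

Lemma schedule_notin L K st x : schedule L K st -> x \in map fst st -> x \notin K.
Proof.
elim: st K => //= s st IH K /andP[/andP[nsK _] ok]; rewrite inE => /predU1P[->//|xst].
by have := IH _ ok xst; rewrite !inE negb_or => /andP[].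
Qed.

Lemma schedule_uniq L K st : schedule L K st -> uniq (map fst st).
Proof.
elim: st K => //= s st IH K /andP[_ ok]; rewrite (IH _ ok) andbT.
by apply/negP => /(schedule_notin ok); rewrite !inE eqxx.
Qed.

Lemma generated_rcons L k k' S s : generated L k S -> step_ok L S s ->
  (s.2 == None) + k <= k' -> generated L k' (s.1 |: S).
Proof.
case=> st [ok ES nst] oks lek; exists (rcons st s); split.
- by rewrite schedule_rcons ok set0U ES.
- by rewrite map_rcons -ES; apply/setP => x; rewrite !inE mem_rcons inE.
- by rewrite /free_steps -cats1 count_cat /= addn0 addnC (leq_trans _ lek) // leq_add2l.
Qed.

Lemma generated0 L : generated L 0 set0.
Proof. by exists [::]; split=> //; apply/setP => x; rewrite !inE. Qed.

Lemma generated_free L k S x : generated L k S -> x \notin S ->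
  generated L k.+1 (x |: S).
Proof.
by move=> g nx; apply: (generated_rcons (s := (x, None)) g); rewrite // /step_ok nx.
Qed.

Lemma generated_line L k S a b x : generated L k S -> a \in S -> b \in S ->
  [set a; b; x] \in L -> generated L k (x |: S).
Proof.
move=> g aS bS lL; case: (boolP (x \in S)) => xS; first by rewrite (setUidPr _) ?sub1set.
by apply: (generated_rcons (s := (x, Some (a, b))) g); rewrite // /step_ok /= xS aS bS lL.
Qed.
End Generation.

(** * Four generators suffice for a full configuration with at most seven lines *)

Section FullConfigurations.
Variables (T : finType) (X : {set T}) (L : {set {set T}}).
Hypotheses (XL : triples_on X L) (linL : linear L).
Hypothesis full : forall x, x \in X -> 1 < #|[set l in L | x \in l]|.
Implicit Types (S K l : {set T}) (x y : T).

(** As long as some line has two points in [S] and the third outside, that point is added by a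
    forced step. This costs no generator, and the number of missing points decreases. *)
Lemma generated_closure k S : generated L k S -> S \subset X ->
  exists S', [/\ generated L k S', S \subset S', S' \subset X & closed_in L S'].
Proof.
have [n] := ubnP (#|X| - #|S|); elim: n S => // n IH S le_n gS SX.
case: (boolP (closed_in L S)) => [clS|]; first by exists S.
rewrite negb_forall => /existsP[l]; rewrite !negb_imply => /and3P[lL cl /subsetPn[x xl xS]].
have [l3 /subsetP lX] := XL lL.
have [q [r [nqr nqx nrx E]]] := card3_split l3 xl.
have qrS : (q \in S) && (r \in S).
  apply: contraTT cl; rewrite negb_and -leqNgt => nS.
  have [z sub] : exists z, l :&: S \subset [set z].
    case/orP: nS => nS; [exists r|exists q]; apply/subsetP => z; rewrite E !inE.
      by case/andP=> /orP[/orP[]|]/eqP-> //; rewrite ?(negPf nS) ?(negPf xS).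
    by case/andP=> /orP[/orP[]|]/eqP-> //; rewrite ?(negPf nS) ?(negPf xS).
  by rewrite (leq_trans (subset_leq_card sub)) ?cards1.
case/andP: qrS => qS rS.
have gS' : generated L k (x |: S) by apply: generated_line gS qS rS _; rewrite -E.
have S'X : x |: S \subset X by rewrite subUset sub1set lX.
have lt_card : #|x |: S| <= #|X| by apply: subset_leq_card.
have lt_n : #|X| - #|x |: S| < n.
  move: lt_card le_n; rewrite cardsU1 xS add1n => h1 h2; clear - h1 h2; lia.
have [S2 [g2 s2 sX2 c2]] := IH _ lt_n gS' S'X.
by exists S2; split=> //; apply: subset_trans s2; apply: subsetUr.
Qed.

Lemma other_line x l : x \in X -> exists2 l', l' \in L & (x \in l') && (l' != l).
Proof.
move/full; rewrite (cardsD1 l) => H.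
have /card_gt0P[l'] : 0 < #|[set l0 in L | x \in l0] :\ l| by move: H; case: (l \in _) => //; apply: ltnW.
by rewrite !inE => /and3P[nl lL xl]; exists l'; rewrite ?xl.
Qed.

(** Take a line in [S] and a second line through each of its three points. Linearity makes these
    four lines distinct, and all of them stay in [S]. *)
Lemma four_lines S : S \subset X -> S != set0 ->
  (forall l, l \in L -> (l \subset S) || [disjoint l & S]) ->
  4 <= #|[set l in L | l \subset S]|.
Proof.
move=> /subsetP SX /set0Pn[x xS] split_S.
have inS l y : l \in L -> y \in l -> y \in S -> l \subset S.
  move=> lL yl yS; case/orP: (split_S l lL) => // /disjointFr/(_ yl).
  by rewrite yS.
(* The empty set is a dummy here: any line through [x] will do. *)
have [l lL /andP[xl _]] := other_line set0 (SX x xS).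
have [l3 _] := XL lL; have lS := inS l x lL xl xS.
have [q [r [nqr nqx nrx E]]] := card3_split l3 xl.
have ql : q \in l by rewrite E !inE eqxx.
have rl : r \in l by rewrite E !inE eqxx orbT.
have qS := subsetP lS q ql; have rS := subsetP lS r rl.
have [lx lxL /andP[xlx nx]] := other_line l (SX x xS).
have [lq lqL /andP[qlq nq]] := other_line l (SX q qS).
have [lr lrL /andP[rlr nr]] := other_line l (SX r rS).
have u : uniq [:: l; lx; lq; lr].
  rewrite /= !inE !negb_or ![l == _]eq_sym nx nq nr /= !andbT.
  rewrite -andbA; apply/and3P; split; apply/eqP => El; subst.
  - by move/eqP: nq; case; apply: linL nqx _ _ _ _.
  - by move/eqP: nr; case; apply: linL nrx _ _ _ _.
  - by move/eqP: nr; case; apply: linL nqr _ _ _ _.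
rewrite -[4]/(size [:: l; lx; lq; lr]) cardE.
apply: uniq_leq_size => // l'; rewrite !inE mem_enum inE.
case/or4P=> /eqP->; first by rewrite lL.
- by rewrite lxL (inS _ x).
- by rewrite lqL (inS _ q).
- by rewrite lrL (inS _ r).
Qed.

Hypothesis card_L : #|L| <= 7.

(** Counting incidences in two ways gives [2 * #|X| <= 3 * #|L| <= 21]. *)
Lemma card_full : #|X| <= 10.
Proof.
suff : 2 * #|X| <= 3 * #|L| by lia.
have -> : 3 * #|L| = \sum_(l in L) \sum_(x in X) (x \in l).
  rewrite mulnC -sum_nat_const; apply: eq_bigr => l lL.
  have [<- lX] := XL lL; rewrite -sum1_card big_mkcond [RHS]big_mkcond.
  by apply: eq_bigr => x _; case: (boolP (x \in l)) => [/(subsetP lX)->|]; rewrite ?if_same.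
rewrite exchange_big mulnC -sum_nat_const; apply: leq_sum => x xX.
apply: leq_trans (full xX) _; rewrite -sum1_card big_mkcond [leqRHS]big_mkcond.
by apply: leq_sum => l _; rewrite inE; case: (l \in L); case: (x \in l).
Qed.

(** A new generator on a line that meets [S] in a single point forces the third point of that line,
    so one generator brings two points. *)
Lemma generated_grow k S : generated L k S -> S \subset X -> S != set0 ->
  closed_in L S -> S != X ->
  exists S', [/\ generated L k.+1 S', #|S| + 2 <= #|S'|, S' \subset X & closed_in L S'].
Proof.
move=> gS SX S0 /forall_inP clS SnX.
case: (boolP [exists l in L, #|l :&: S| == 1]) => [/exists_inP[l lL /cards1P[p lS]]|].
  have pl : p \in l by have : p \in l :&: S; [rewrite lS set11|rewrite inE => /andP[]].
  have pS : p \in S by have : p \in l :&: S; [rewrite lS set11|rewrite inE => /andP[]].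
  have [l3 /subsetP lX] := XL lL.
  have [q [r [nqr nqp nrp E]]] := card3_split l3 pl.
  have nS y : y \in l -> y != p -> y \notin S.
    by move=> yl; apply: contraNN => yS; rewrite -in_set1 -lS inE yl yS.
  have ql : q \in l by rewrite E !inE eqxx.
  have rl : r \in l by rewrite E !inE eqxx orbT.
  have g1 := generated_free gS (nS q ql nqp).
  have g2 : generated L k.+1 (r |: (q |: S)).
    apply: (generated_line (a := q) (b := p) g1); rewrite ?inE ?eqxx ?pS ?orbT //.
    by rewrite setUAC -E.
  have sX : r |: (q |: S) \subset X by rewrite !subUset !sub1set !lX.
  have [S' [g' sS' S'X cl']] := generated_closure g2 sX; exists S'; split=> //.
  apply: leq_trans (subset_leq_card sS').
  rewrite !cardsU1 !inE !negb_or (nS q ql nqp) (nS r rl nrp) (eq_sym r q) nqr.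
  by rewrite !add1n addn2.
(* Otherwise [S] and its complement are unions of components, and a full
   configuration has at least four lines. *)
rewrite negb_exists => /forallP nomeet.
have split_S l : l \in L -> (l \subset S) || [disjoint l & S].
  move=> lL; have := clS l lL; have := nomeet l; rewrite lL /= -setI_eq0 -cards_eq0.
  by case: (#|_|) => [|[|n]] //=; [rewrite orbT|move=> _ ->].
have h1 := four_lines SX S0 split_S.
have h2 : 4 <= #|[set l in L | l \subset X :\: S]|.
  apply: four_lines; first exact: subsetDl.
    rewrite setD_eq0; apply: contraNN SnX => XS; apply/eqP/setP/subset_eqP.
    by rewrite SX XS.
  move=> l lL; have [l3 lX] := XL lL; case/orP: (split_S l lL) => H.
    apply/orP; right; rewrite disjoint_sym disjoints_subset; apply/subsetP => z.
    by rewrite !inE => /andP[nz _]; apply: contraNN nz; apply/subsetP.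
  by apply/orP; left; rewrite subsetD lX.
(* The two families are disjoint, so [L] would have at least eight lines. *)
have : #|[set l in L | l \subset S]| + #|[set l in L | l \subset X :\: S]| <= #|L|.
  rewrite -cardsUI [X in _ + X](_ : _ = 0); last first.
    apply: eq_card0 => l; rewrite !inE; apply/negP => /andP[/andP[lL lS] /andP[_ lXS]].
    have [l3 _] := XL lL; have /card_gt0P[z zl] : 0 < #|l| by rewrite l3.
    by have := subsetP lXS z zl; rewrite inE (subsetP lS z zl).
  rewrite addn0; apply: subset_leq_card; apply/subsetP => l; rewrite !inE.
  by case/orP => /andP[].
by lia.
Qed.

(** If the other two points of [l] were both in [S], closedness would put [x] there too. *)
Lemma closed_line_outside S l x : closed_in L S -> l \in L -> x \in l -> x \notin S ->
  exists2 y, y \in l & (y != x) && (y \notin S).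
Proof.
move=> /forall_inP/(_ l) clS lL xl xS; have [l3 _] := XL lL.
have [q [r [nqr nqx nrx E]]] := card3_split l3 xl.
have ql : q \in l by rewrite E !inE eqxx.
have rl : r \in l by rewrite E !inE eqxx orbT.
case: (boolP (q \in S)) => qS; last by exists q; rewrite ?nqx.
case: (boolP (r \in S)) => rS; last by exists r; rewrite ?nrx.
have : l \subset S.
  apply: (implyP (clS lL)); rewrite (cardD1 q) (cardD1 r) !inE ql qS rl rS.
  by rewrite eq_sym nqr.
by move/subsetP/(_ x xl); rewrite (negPf xS).
Qed.

(** A missing point lies on two lines, each with a further missing point; by linearity these two
    points differ. *)
Lemma closed_complement S : closed_in L S -> S \subset X -> S != X ->
  exists x y1 y2 l1 l2,
    [/\ [/\ x \notin S, y1 \notin S & y2 \notin S],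
        [/\ y1 != x, y2 != x & y1 != y2], [/\ l1 \in L, l2 \in L & l1 != l2] &
        [/\ x \in l1, y1 \in l1, x \in l2 & y2 \in l2]].
Proof.
move=> clS SX SnX; have /subsetPn[x xX xS] : ~~ (X \subset S).
  by apply: contraNN SnX => XS; apply/eqP/setP/subset_eqP; rewrite SX XS.
have [l1 l1L /andP[xl1 _]] := other_line set0 xX.
have [l2 l2L /andP[xl2 n21]] := other_line l1 xX.
have [y1 y1l /andP[ny1 y1S]] := closed_line_outside clS l1L xl1 xS.
have [y2 y2l /andP[ny2 y2S]] := closed_line_outside clS l2L xl2 xS.
exists x, y1, y2, l1, l2; split; split=> //; last by rewrite eq_sym.
apply: contraNneq n21 => E; apply/eqP; subst y2.
by apply: (linL _ _ ny1).
Qed.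

Lemma closed_complement_card S : closed_in L S -> S \subset X -> S != X ->
  #|S| + 3 <= #|X|.
Proof.
move=> clS SX SnX.
have [x [y1 [y2 [l1 [l2 [[xS y1S y2S] [n1 n2 n12] [l1L l2L _] [xl1 y1l _ y2l]]]]]]]
  := closed_complement clS SX SnX.
have [_ /subsetP s1] := XL l1L; have [_ /subsetP s2] := XL l2L.
suff /subset_leq_card : y2 |: (y1 |: (x |: S)) \subset X.
  by rewrite !cardsU1 !inE !negb_or xS y1S y2S n1 n2 (eq_sym y2 y1) n12 !add1n addn3.
by rewrite !subUset !sub1set SX s2 // !s1.
Qed.

Theorem full_generated : generated L 4 X.
Proof.
suff [S gS E] : exists2 S, generated L 4 S & S = X by rewrite -E.
have [->|/set0Pn[x0 x0X]] := eqVneq X set0.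
  exists set0 => //; have [st [? ? le0]] := generated0 L; exists st; split=> //.
  exact: leq_trans le0 _.
have cX := card_full.
have weaken k S : generated L k S -> k <= 4 -> generated L 4 S.
  by case=> st [? ? le_k] k4; exists st; split=> //; apply: leq_trans k4.
have ne S : 0 < #|S| -> S != set0 by rewrite card_gt0.
have grow k S : generated L k S -> S \subset X -> 0 < #|S| -> closed_in L S -> k < 4 ->
    (exists2 S', generated L 4 S' & S' = X) \/
    exists S', [/\ generated L k.+1 S', #|S| + 2 <= #|S'|, S' \subset X & closed_in L S'].
  move=> gS SX S0 clS lt_k; have [E|nE] := eqVneq S X.
    by left; exists S => //; apply: weaken gS (ltnW lt_k).
  by right; apply: generated_grow => //; apply: ne.
have [S1 [g1 s1 S1X cl1]] : exists S',
    [/\ generated L 1 S', [set x0] \subset S', S' \subset X & closed_in L S'].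
  apply: generated_closure; last by rewrite sub1set.
  by rewrite -[[set x0]]setU0; apply: generated_free (generated0 L) _; rewrite inE.
have c1 : 0 < #|S1| by apply: leq_trans (subset_leq_card s1); rewrite cards1.
(* Each round exhausts [X] or adds two points, so the sizes are at least 1, 3, 5, 7. *)
case: (grow _ _ g1 S1X c1 cl1 isT) => // -[S2 [g2 c2 S2X cl2]].
have c2' : 0 < #|S2| by apply: leq_trans c2; rewrite addn2.
case: (grow _ _ g2 S2X c2' cl2 isT) => // -[S3 [g3 c3 S3X cl3]].
have c3' : 0 < #|S3| by apply: leq_trans c3; rewrite addn2.
case: (grow _ _ g3 S3X c3' cl3 isT) => // -[S4 [g4 c4 S4X cl4]].
have [E|nE] := eqVneq S4 X; first by exists S4.
(* Four greedy generators leave exactly the three points of a triangle, from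
   which three points reach six. *)
have cS4 : #|S4| + 3 <= #|X| by apply: closed_complement_card.
have [x [y1 [y2 [l1 [l2 [[xS y1S y2S] [n1 n2 n12] [l1L l2L nl] [xl1 y1l xl2 y2l]]]]]]]
  := closed_complement cl4 S4X nE.
have [l13 /subsetP l1X] := XL l1L; have [l23 /subsetP l2X] := XL l2L.
(* A fourth missing point would give at least 7 + 4 > 10 points. *)
have out z : z \in X -> z \notin S4 -> [|| z == x, z == y1 | z == y2].
  move=> zX zS; apply: contraTT cS4; rewrite !negb_or => /and3P[nx ny1 ny2].
  suff /subset_leq_card : z |: (y2 |: (y1 |: (x |: S4))) \subset X.
    rewrite !cardsU1 !inE !negb_or xS y1S y2S n1 n2 (eq_sym y2 y1) n12 nx ny1 ny2 zS.
    by rewrite !add1n -ltnNge addn3; move: c4 c3 c2 c1 cX; clear; lia.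
  by rewrite !subUset !sub1set S4X zX l2X // !l1X.
have [l3 l3L /andP[y1l3 nl31]] := other_line l1 (l1X _ y1l).
have nx3 : x \notin l3.
  by apply: contraNN nl31 => xl3; apply/eqP; apply: (linL _ _ n1).
have y2l1 : y2 \notin l1.
  by apply: contraNN nl => H; apply/eqP; apply: (linL _ _ n2).
have y1l2 : y1 \notin l2.
  by apply: contraNN nl => H; apply/eqP; apply: (linL _ _ n1).
have [l33 /subsetP l3X] := XL l3L.
(* The second line through [y1] has another missing point; it is not [x], hence it is [y2], and the
   triangle closes. *)
have y2l3 : y2 \in l3.
  have [z zl3 /andP[nz zS]] := closed_line_outside cl4 l3L y1l3 y1S.
  case/or3P: (out z (l3X _ zl3) zS) => /eqP Ez; subst z => //.
    by rewrite zl3 in nx3.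
  by rewrite eqxx in nz.
have nl32 : l3 != l2 by apply: contraNneq nx3 => ->.
(* On each side of the triangle the third point lies in [S4], since the only other missing point is
   the opposite vertex, which is off that side. *)
have third l a b c : l \in L -> a \in l -> b \in l -> a != b -> c \notin l ->
    (forall z, z \in X -> z \notin S4 -> [|| z == a, z == b | z == c]) ->
    exists s, [/\ s \in S4, s \in l & l = [set a; b; s]].
  move=> lL al bl nab cl outl; have [lc /subsetP lX] := XL lL.
  have [s [sa sb El]] := card3_split2 lc al bl nab; exists s.
  have sl : s \in l by rewrite El !inE eqxx orbT.
  split=> //; apply: contraNT cl => sS.
  by have := outl s (lX _ sl) sS; rewrite (negPf sa) (negPf sb) /= => /eqP<-.
have [s1' [s1S s1l E1]] : exists s, [/\ s \in S4, s \in l1 & l1 = [set x; y1; s]].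
  by apply: (third _ _ _ y2) => //; rewrite eq_sym.
have [s2' [s2S s2l E2]] : exists s, [/\ s \in S4, s \in l2 & l2 = [set x; y2; s]].
  apply: (third _ _ _ y1) => //; first by rewrite eq_sym.
  by move=> z zX zS; case/or3P: (out z zX zS) => ->; rewrite ?orbT.
have [s3' [s3S s3l E3]] : exists s, [/\ s \in S4, s \in l3 & l3 = [set y1; y2; s]].
  apply: (third _ _ _ x) => // z zX zS.
  by case/or3P: (out z zX zS) => ->; rewrite ?orbT.
have nS z s : z \notin S4 -> s \in S4 -> z != s by move=> zS; apply: contraTneq => <-.
(* Two sides share a vertex outside [S4]; a common point in [S4] as well would make them equal. *)
have d12 : s1' != s2'.
  apply: contraNneq nl => E; apply/eqP; apply: (linL _ _ (nS x s1' xS s1S)) => //.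
  by rewrite E.
have d13 : s1' != s3'.
  apply: contraNneq nl31 => E; apply/eqP; apply: (linL _ _ (nS y1 s1' y1S s1S)) => //.
  by rewrite E.
have d23 : s2' != s3'.
  apply: contraNneq nl32 => E; apply/eqP; apply: (linL _ _ (nS y2 s2' y2S s2S)) => //.
  by rewrite E.
(* The vertices are three free generators, and the third points of the sides are forced. *)
pose S0 := s3' |: (s2' |: (s1' |: (y2 |: (y1 |: (x |: set0))))).
have gS0 : generated L 3 S0.
  apply: (generated_line (a := y1) (b := y2)); rewrite -?E3 ?inE ?eqxx ?orbT //.
  apply: (generated_line (a := x) (b := y2)); rewrite -?E2 ?inE ?eqxx ?orbT //.
  apply: (generated_line (a := x) (b := y1)); rewrite -?E1 ?inE ?eqxx ?orbT //.
  apply: generated_free; last by rewrite !inE !negb_or n2 eq_sym n12.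
  apply: generated_free; last by rewrite !inE orbF.
  by apply: generated_free (generated0 L) _; rewrite inE.
have S0X : S0 \subset X.
  rewrite /S0 !subUset !sub1set sub0set (l1X x) // (l1X y1) // (l2X y2) //.
  by rewrite !(subsetP S4X).
have cS0 : #|S0| = 6.
  have nS' s z : s \in S4 -> z \notin S4 -> s != z by move=> sS zS; rewrite eq_sym nS.
  rewrite /S0 !cardsU1 !inE !negb_or (eq_sym s3' s2') (eq_sym s3' s1') (eq_sym s2' s1').
  by rewrite (eq_sym y2 y1) d23 d13 d12 n12 n1 n2 !nS' // cards0.
have [S5 [g5 sub5 S5X cl5]] := generated_closure gS0 S0X.
have c5 := subset_leq_card sub5; rewrite cS0 in c5.
have c5' : 0 < #|S5| by apply: leq_trans c5.
case: (grow _ _ g5 S5X c5' cl5 isT) => // -[S6 [g6 c6 S6X cl6]].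
have [E|nE6] := eqVneq S6 X; first by exists S6.
(* A proper closed set with at least 6 + 2 points would require 11 points in [X]. *)
have := closed_complement_card cl6 S6X nE6; move: c6 c5 cX; clear; lia.
Qed.

End FullConfigurations.

(** * Summation along a schedule *)

Section ScheduledCount.
Variables (T : finType) (v : nat) (t : nat -> nat -> nat).
Implicit Types (L : {set {set T}}) (K : {set T}) (st : seq (step T)).
Implicit Types (e : T -> nat) (P : (T -> nat) -> nat).

Fixpoint scount st P e : nat :=
  match st with
  | [::] => P e
  | (x, None) :: st' => \sum_(a < v) scount st' P (assign e x a)
  | (x, Some (a, b)) :: st' => scount st' P (assign e x (t (e a) (e b)))
  end.

Lemma card3_neq (a b x : T) : #|[set a; b; x]| = 3 -> [/\ a != b, a != x & b != x].
Proof.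
rewrite setUC cardsU1 cards2 !inE negb_or ![x == _]eq_sym.
by case: (a == b); case: (a == x); case: (b == x).
Qed.

(** At a forced step only one value of the full sum can contribute: any other one violates the
    forcing line, and then the summand is 0. *)
Lemma scount_isum L K st P e : sts_op v t -> (forall l, l \in L -> #|l| = 3) ->
  (forall e', P e' != 0 -> forall l, l \in L -> line_ok t e' l) ->
  schedule L K st -> (forall x, x \in K -> e x < v) ->
  scount st P e = isum v (map fst st) P e.
Proof.
move=> St L3 homP; elim: st K e => [//|[x [[a b]|]] st IH] K e /=; last first.
  case/andP=> _ ok lt_e; apply: eq_bigr => c _; apply: IH ok _ => y.
  by rewrite !inE /assign; case: eqP => //= _; apply: lt_e.
case/andP=> /andP[/= nxK /and3P[aK bK lL]] ok lt_e.
have [nab nax nbx] := card3_neq (L3 _ lL).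
pose w := t (e a) (e b); have wv : w < v by apply: (op_lt St); apply: lt_e.
rewrite (@sum_ord_eq _ w (fun c => isum v (map fst st) P (assign e x c))) //.
  apply: IH ok _ => y; rewrite !inE /assign; case: eqP => //= _; exact: lt_e.
move=> c ncw; rewrite -(isum_const0 v (map fst st) (assign e x c)).
apply: eq_isum => e' _ eq_e'; apply/eqP; apply: contraNT ncw => /homP/(_ _ lL).
(* Later steps never reassign a point, so the values on the forcing line are final. *)
have nst y : y \in x |: K -> y \notin map fst st.
  by move=> yK; apply/negP => /(schedule_notin ok); rewrite yK.
move/line_okP/(_ a b x); rewrite !eq_e' ?nst ?inE ?eqxx ?aK ?bK ?orbT //.
by rewrite /assign eqxx (negPf nax) (negPf nbx) => <-.
Qed.

End ScheduledCount.

(** * Programs on the word RAM *)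

(** Total correctness with an upper bound on the time, so that costs compose by inequalities. *)
Definition runs (M : nat) (c : cmd) (m : memory) (tmax : nat)
    (Q : memory -> Prop) : Prop :=
  exists t m', [/\ exec M c m t m', t <= tmax & Q m'].

Section Runs.
Variable M : nat.
Implicit Types (c : cmd) (m : memory) (Q : memory -> Prop).

Lemma runs_write a e m tmax Q : cost a + cost e < tmax ->
  Q (update m (eval M m a) (eval M m e)) -> runs M (Write a e) m tmax Q.
Proof.
by move=> le_t HQ; exists (cost a + cost e).+1, (update m (eval M m a) (eval M m e));
   split=> //; constructor.
Qed.

Lemma runs_seq c1 c2 m t1 t2 tmax Q :
  runs M c1 m t1 (fun m1 => runs M c2 m1 t2 Q) -> t1 + t2 <= tmax ->
  runs M (Seq c1 c2) m tmax Q.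
Proof.
move=> [u1 [m1 [x1 l1 [u2 [m2 [x2 l2 HQ]]]]]] le_t.
exists (u1 + u2), m2; split=> //; first exact: ExecSeq x1 x2.
by apply: leq_trans le_t; apply: leq_add.
Qed.

Lemma runs_weaken c m t1 t2 (Q1 Q2 : memory -> Prop) :
  runs M c m t1 Q1 -> t1 <= t2 -> (forall m', Q1 m' -> Q2 m') -> runs M c m t2 Q2.
Proof.
move=> [u [m1 [x1 l1 q1]]] le_t HQ; exists u, m1; split=> //; last exact: HQ.
exact: leq_trans le_t.
Qed.

(** [I i] is the invariant after [i] rounds. The last summand of the time pays for the final,
    failing test. *)
Lemma runs_while e c (I : nat -> memory -> Prop) N m tc :
  (forall i m1, i < N -> I i m1 -> eval M m1 e != 0 /\ runs M c m1 tc (I i.+1)) ->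
  (forall m1, I N m1 -> eval M m1 e = 0) -> I 0 m ->
  runs M (While e c) m (N * (tc + (cost e).+1) + (cost e).+1) (I N).
Proof.
move=> Hstep Hend I0.
suff H d' m1 : d' <= N -> I (N - d') m1 ->
    runs M (While e c) m1 (d' * (tc + (cost e).+1) + (cost e).+1) (I N).
  by apply: H; rewrite ?subnn.
elim: d' m1 => [|d' IH] m1 le_d Im.
  rewrite subn0 in Im; exists (cost e).+1, m1; split=> //.
  by apply: ExecWhileFalse; apply: Hend.
have lt_N : N - d'.+1 < N by lia.
have [e1 [u1 [m2 [x1 l1 I2]]]] := Hstep _ _ lt_N Im.
rewrite (_ : (N - d'.+1).+1 = N - d') in I2; last by lia.
have [u2 [m3 [x2 l2 I3]]] := IH m2 (ltnW le_d) I2.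
exists (cost e + u1 + u2).+1, m3; split=> //; first exact: ExecWhileTrue e1 x1 x2.
by rewrite mulSn; lia.
Qed.

End Runs.

(** * Registers at the top of memory and the table of third points *)

Definition reg (i : nat) : expr := Op OSub (Const 0) (Const i).

(** The program does not know [M]; the wraparound of [0 - i] reaches the top cells, away from input
    and table. *)
Lemma eval_reg M m i : 0 < i < M -> eval M m (reg i) = M - i.
Proof.
by move=> iM; rewrite /= mod0n add0n (modn_small (m := i)) ?modn_small; lia.
Qed.

Lemma updateE m a x i : update m a x i = if i == a then x else m i.
Proof. by []. Qed.

(* The entry for [t a b] in a table stored right after the input, for [n] lines. *)
Definition table_cell (n v a b : nat) : nat := 2 + 3 * n + (a * v + b).

Definition table_addr (ea eb : expr) : expr :=
  Op OAdd (Op OAdd (Const 2) (Op OMul (Const 3) (Read (Const 1))))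
          (Op OAdd (Op OMul ea (Read (Const 0))) eb).

Record layout (v n : nat) (t : nat -> nat -> nat) (m : memory) : Prop := Layout {
  layout_v : m 0 = v;
  layout_n : m 1 = n;
  layout_t : forall a b, a < v -> b < v -> m (table_cell n v a b) = t a b }.

Lemma table_cell_lt n v a b : a < v -> b < v -> table_cell n v a b < 2 + 3 * n + v * v.
Proof.
move=> av bv; rewrite /table_cell ltn_add2l.
have : a.+1 * v <= v * v by rewrite leq_mul2r av orbT.
by rewrite mulSn; apply: leq_trans; rewrite addnC ltn_add2r.
Qed.

Lemma table_cell_inj n v a b a' b' : b < v -> b' < v ->
  table_cell n v a b = table_cell n v a' b' -> a = a' /\ b = b'.
Proof.
move=> bv bv' /addnI E; have v_gt0 : 0 < v by apply: leq_ltn_trans bv.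
split; first by have := congr1 (divn^~ v) E; rewrite /= !divnMDl // !divn_small // !addn0.
by have := congr1 (modn^~ v) E; rewrite /= !modnMDl !modn_small.
Qed.

Lemma eval_table_addr M v n m ea eb a b :
  2 + 3 * n + v * v < M -> 3 < M -> m 0 = v -> m 1 = n -> a < v -> b < v ->
  eval M m ea = a -> eval M m eb = b ->
  eval M m (table_addr ea eb) = table_cell n v a b.
Proof.
move=> room M3 m0 m1 av bv Ea Eb; have lt := table_cell_lt n av bv.
rewrite /table_addr /= mod0n (modn_small (m := 1)); last by lia.
rewrite m0 m1 Ea Eb (modn_small (m := 2)) ?(modn_small (m := 3)) //; last by lia.
move: lt; rewrite /table_cell => lt.
by rewrite (modn_small (m := 3 * n)) ?(modn_small (m := a * v))
           ?(modn_small (m := 2 + 3 * n)) ?(modn_small (m := a * v + b))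
           ?modn_small //; lia.
Qed.

(** The [k] topmost cells lie above the table, so registers can change freely. *)
Lemma layout_frame M v n k t m m' : 2 + 3 * n + v * v + k < M ->
  (forall i, i < M - k -> m' i = m i) -> layout v n t m -> layout v n t m'.
Proof.
move=> room E [m0 m1 mt]; split; [rewrite E //; lia|rewrite E //; lia|].
move=> a b av bv; rewrite E ?mt //.
by have := table_cell_lt n av bv; lia.
Qed.

(** A conjunction, as the product of truth values 0 and 1. *)
Definition all_tests (es : seq expr) : expr := foldr (Op OMul) (Const 1) es.

Lemma eval_all_tests (A : eqType) M m (s : seq A) (ex : A -> expr) (b : A -> bool) :
  1 < M -> (forall x, x \in s -> eval M m (ex x) = b x) ->
  eval M m (all_tests (map ex s)) = all b s.
Proof.
move=> M1; elim: s => [|x s IH] H /=; first by rewrite modn_small.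
rewrite H ?mem_head // IH => [|y ys]; last by apply: H; rewrite inE ys orbT.
by rewrite mulnb modn_small //; case: (_ && _) => //; apply: ltnW.
Qed.

(** * Loop nests that follow a schedule *)

Section LoopNest.
Variables (T : finType) (r : nat).
Implicit Types (X K : {set T}) (L : {set {set T}}) (st : seq (step T)) (x : T).

(** Register [r] itself is the accumulator; the points use the registers after it. *)
Definition preg x : nat := (r + enum_rank x).+1.

Fixpoint loops (body : cmd) st : cmd :=
  match st with
  | [::] => body
  | (x, None) :: st' =>
      Seq (Write (reg (preg x)) (Const 0))
          (While (Op OLt (Read (reg (preg x))) (Read (Const 0)))
                 (Seq (loops body st')
                      (Write (reg (preg x)) (Op OAdd (Read (reg (preg x))) (Const 1)))))
  | (x, Some (a, b)) :: st' =>
      Seq (Write (reg (preg x))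
                 (Read (table_addr (Read (reg (preg a))) (Read (reg (preg b))))))
          (loops body st')
  end.

Fixpoint loops_time (v tb : nat) st : nat :=
  match st with
  | [::] => tb
  | (_, None) :: st' => v * (loops_time v tb st' + 30) + 30
  | (_, Some _) :: st' => 30 + loops_time v tb st'
  end.

(** The base [v.+1] absorbs the constant overhead even when [v] is 0. *)
Lemma loops_time_bound tb st :
  exists c, forall v, loops_time v tb st <= c * v.+1 ^ free_steps st.
Proof.
elim: st => [|[x [ab|]] st [c IH]].
- by exists tb => v; rewrite muln1.
- exists (c + 30) => v; have := IH v; rewrite /free_steps /= add0n.
  have : 0 < v.+1 ^ count (fun s : step T => s.2 == None) st by rewrite expn_gt0.
  by nia.
exists (c + 30) => v; have := IH v; rewrite /free_steps /= add1n expnS.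
have : 0 < v.+1 ^ count (fun s : step T => s.2 == None) st by rewrite expn_gt0.
by nia.
Qed.

Variables (M v n k : nat) (t : nat -> nat -> nat).
Hypotheses (r_gt0 : 0 < r) (rk : r + #|T| <= k) (room : 2 + 3 * n + v * v + k < M).

Lemma preg_bound x : r < preg x <= k.
Proof.
rewrite /preg ltnS leq_addr /=; apply: leq_trans rk.
by rewrite -addnS leq_add2l; apply: ltn_ord.
Qed.

Lemma preg_inj x y : M - preg x = M - preg y -> x = y.
Proof.
move=> E; have : preg x = preg y.
  by have := preg_bound x; have := preg_bound y; move: E room; clear; lia.
by case=> /addnI/val_inj/enum_rank_inj.
Qed.

Lemma eval_preg m x : eval M m (reg (preg x)) = M - preg x.
Proof. by apply: eval_reg; have := preg_bound x; lia. Qed.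

Lemma eval_rpreg m x : eval M m (Read (reg (preg x))) = m (M - preg x).
Proof. by rewrite -(eval_preg m x). Qed.

(** Induction on the schedule, with [K] the points that already have values. The bound on the final
    value of the accumulator excludes wraparound; besides it only registers of points outside [K]
    may change. *)
Lemma loops_run X L body tb (P : (T -> nat) -> nat) st K e m :
  sts_op v t ->
  (forall m e, layout v n t m ->
     (forall x, x \in X -> m (M - preg x) = e x /\ e x < v) ->
     m (M - r) + P e < M ->
     runs M body m tb (fun m' => m' (M - r) = m (M - r) + P e /\
                                forall i, i != M - r -> m' i = m i)) ->
  layout v n t m -> schedule L K st ->
  X \subset K :|: [set x in map fst st] ->
  (forall x, x \in K -> m (M - preg x) = e x /\ e x < v) ->
  m (M - r) + scount v t st P e < M ->
  runs M (loops body st) m (loops_time v tb st) (fun m' =>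
     m' (M - r) = m (M - r) + scount v t st P e /\
     forall i, i != M - r -> (forall x, x \notin K -> i != M - preg x) -> m' i = m i).
Proof.
move=> St body_spec.
have preg_r x : M - preg x == M - r = false by have := preg_bound x; lia.
have low x i : i < M - k -> i != M - preg x by have := preg_bound x; lia.
have lowr i : i < M - k -> i != M - r by lia.
elim: st K e m => [|[x [[a b]|]] st IH] K e m lay /=.
- move=> _ XK Ke lt_M; apply: runs_weaken (body_spec m e lay _ lt_M) (leqnn _) _.
    by move=> x xX; apply: Ke; move/subsetP/(_ x xX): XK; rewrite !inE orbF.
  by move=> m' [E fr]; split=> // i ir _; apply: fr.
- case/andP=> /andP[/= nxK /and3P[aK bK lL]] ok XK Ke lt_M.
  have [Ea la] := Ke a aK; have [Eb lb] := Ke b bK.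
  have w_lt : t (e a) (e b) < v by apply: (op_lt St).
  apply: (@runs_seq _ _ _ _ 25 (loops_time v tb st)); last by lia.
  apply: runs_write => //; rewrite eval_preg.
  have Eab : eval M m (table_addr (Read (reg (preg a))) (Read (reg (preg b))))
             = table_cell n v (e a) (e b).
    apply: eval_table_addr (layout_v lay) (layout_n lay) la lb _ _;
      rewrite ?eval_rpreg //; move: room rk r_gt0; clear; lia.
  have -> : eval M m (Read (table_addr (Read (reg (preg a))) (Read (reg (preg b)))))
            = t (e a) (e b) by rewrite -(layout_t lay la lb) -Eab.
  set m1 := update _ _ _.
  have m1r : m1 (M - r) = m (M - r) by rewrite /m1 updateE eq_sym preg_r.
  have Kx y : y \in x |: K -> m1 (M - preg y) = assign e x (t (e a) (e b)) y /\
                              assign e x (t (e a) (e b)) y < v.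
    rewrite !inE /assign /m1 updateE; case: (y =P x) => [->|nyx] /= yK.
      by rewrite eqxx.
    by case: eqP => [/preg_inj//|_]; apply: Ke.
  have lay1 : layout v n t m1.
    apply: layout_frame room _ lay => i ik; rewrite /m1 updateE.
    by rewrite (negPf (low x i ik)).
  apply: runs_weaken (IH (x |: K) (assign e x (t (e a) (e b))) m1 lay1 ok _ Kx _) (leqnn _) _.
  + apply: subset_trans XK _; apply/subsetP => y; rewrite !inE.
    by case/or3P=> ->; rewrite ?orbT.
  + by rewrite m1r.
  move=> m' [E fr]; rewrite E m1r; split=> // i ir iK; rewrite fr //.
    by rewrite /m1 updateE (negPf (iK x nxK)).
  by move=> y; rewrite !inE negb_or => /andP[_ yK]; apply: iK.
case/andP=> /andP[/= nxK _] ok XK Ke lt_M.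
apply: (@runs_seq _ _ _ _ 5 (v * (loops_time v tb st + 10 + 8) + 8)); last by nia.
apply: runs_write => //; rewrite eval_preg [eval _ _ (Const 0)]/= mod0n.
set m1 := update _ _ _.
pose I i m2 := [/\ m2 (M - preg x) = i,
  m2 (M - r) = m (M - r) + \sum_(0 <= a < i) scount v t st P (assign e x a) &
  forall j, j != M - r -> (forall y, y \notin K -> j != M - preg y) -> m2 j = m j].
have layI i m2 : I i m2 -> layout v n t m2.
  case=> _ _ fr; apply: layout_frame room _ lay => j jk; apply: fr; first exact: lowr.
  by move=> y _; apply: low.
have I0 : I 0 m1.
  split; first by rewrite /m1 updateE eqxx.
    by rewrite big_geq // addn0 /m1 updateE eq_sym preg_r.
  by move=> j jr jK; rewrite /m1 updateE (negPf (jK x nxK)).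
have cond i m2 : I i m2 ->
    eval M m2 (Op OLt (Read (reg (preg x))) (Read (Const 0))) = (i < v).
  move=> Ii; have [Ei _ _] := Ii.
  have -> : eval M m2 (Op OLt (Read (reg (preg x))) (Read (Const 0)))
     = (eval M m2 (Read (reg (preg x))) < eval M m2 (Read (Const 0))) %% M by [].
  rewrite eval_rpreg /= mod0n (layout_v (layI _ _ Ii)) Ei modn_small //.
  by case: (i < v); lia.
(* Partial sums stay below the total, hence below [M]. *)
have partial i : i <= v ->
    \sum_(0 <= a < i) scount v t st P (assign e x a)
    <= \sum_(a < v) scount v t st P (assign e x a).
  move=> iv; rewrite -(big_mkord xpredT (fun a => scount v t st P (assign e x a))).
  by rewrite (big_cat_nat (leq0n i) iv) /= leq_addr.
apply: runs_weaken (runs_while (I := I) (N := v) (tc := loops_time v tb st + 10) _ _ I0) _ _.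
- move=> i m2 iv Ii; rewrite (cond _ _ Ii) iv; split=> //.
  have [Ei Er fr] := Ii.
  have lt_M2 : m2 (M - r) + scount v t st P (assign e x i) < M.
    rewrite Er -addnA; apply: leq_ltn_trans lt_M; rewrite leq_add2l.
    by rewrite -big_nat_recr //=; apply: partial.
  have Kx y : y \in x |: K -> m2 (M - preg y) = assign e x i y /\ assign e x i y < v.
    rewrite !inE /assign; case: (y =P x) => [->|nyx] //= yK.
    have [Ey ly] := Ke y yK; rewrite fr ?Ey ?preg_r // => z zK.
    by apply: contraNneq zK => /preg_inj<-.
  apply: runs_seq (leqnn _).
  apply: runs_weaken (IH (x |: K) _ m2 (layI _ _ Ii) ok _ Kx lt_M2) (leqnn _) _.
    apply: subset_trans XK _; apply/subsetP => y; rewrite !inE.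
    by case/or3P=> ->; rewrite ?orbT.
  move=> m3 [E3 fr3]; apply: runs_write => //; rewrite eval_preg.
  have Ex3 : m3 (M - preg x) = i.
    rewrite fr3 ?preg_r // => y; rewrite !inE negb_or => /andP[nyx _].
    by apply: contraNneq nyx => /preg_inj->.
  have -> : eval M m3 (Op OAdd (Read (reg (preg x))) (Const 1)) = i.+1.
    have -> : eval M m3 (Op OAdd (Read (reg (preg x))) (Const 1))
      = (eval M m3 (Read (reg (preg x))) + 1 %% M) %% M by [].
    by rewrite eval_rpreg Ex3 !modn_small //; nia.
  split; first by rewrite updateE eqxx.
    by rewrite updateE eq_sym preg_r E3 Er big_nat_recr //= addnA.
  move=> j jr jK; rewrite updateE (negPf (jK x nxK)) fr3 ?fr //.
  by move=> y; rewrite !inE negb_or => /andP[_ yK]; apply: jK.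
- by move=> m2 Ii; rewrite (cond _ _ Ii) ltnn.
- by rewrite /=; nia.
by move=> m' [_ Er fr]; rewrite Er big_mkord.
Qed.

End LoopNest.

(** * Functions computable from the table in time O(v^4) *)

(** The caller chooses the result register [r]. Lower registers are kept, so programs can be chained
    without losing earlier results, and so are the cells below [M - k], which contain the table. The
    bound on [F] lets the result fit in a word. *)
Definition computes (F : nat -> (nat -> nat -> nat) -> nat) : Prop :=
  forall r, 0 < r -> exists P c k,
  [/\ r <= k, forall v t, sts_op v t -> F v t < v.+2 ^ k &
   forall M v n t m, sts_op v t -> 2 + 3 * n + v * v + k < M -> v.+2 ^ k <= M ->
     layout v n t m ->
     runs M P m (c * v.+1 ^ 4) (fun m' => m' (M - r) = F v t /\
       forall i, (i < M - k) || (M - r < i) -> m' i = m i)].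

Lemma computes_ext F G :
  (forall v t, sts_op v t -> F v t = G v t) -> computes F -> computes G.
Proof.
move=> E cF r r0; have [P [c [k [rk bF HP]]]] := cF r r0.
exists P, c, k; split=> // [v t St|M v n t m St room Mk lay].
  by rewrite -E ?bF.
by rewrite -(E _ _ St); apply: HP lay.
Qed.

Lemma computes_bound F : computes F ->
  exists k, forall v t, sts_op v t -> F v t < v.+2 ^ k.
Proof. by move=> /(_ 1 isT)[_ [_ [k [_ bF _]]]]; exists k. Qed.

Lemma computes_expr F (e : expr) k0 :
  (forall v t, sts_op v t -> F v t < v.+2 ^ k0) ->
  (forall M v n t m, v.+2 ^ k0 <= M -> layout v n t m -> sts_op v t ->
     eval M m e = F v t) ->
  computes F.
Proof.
move=> bF He r r0; exists (Write (reg r) e), (cost e + 4), (k0 + r).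
have le_k v : v.+2 ^ k0 <= v.+2 ^ (k0 + r) by rewrite leq_pexp2l ?leq_addr.
split=> [|v t St|M v n t m St room Mk lay]; first exact: leq_addl.
  exact: leq_trans (bF v t St) (le_k v).
have M_r : 0 < r < M by rewrite r0; move: room; clear; lia.
apply: runs_write.
  have : 0 < v.+1 ^ 4 by rewrite expn_gt0.
  by rewrite /=; nia.
rewrite eval_reg // (He M v n t) //; last exact: leq_trans (le_k v) Mk.
rewrite updateE eqxx; split=> // i Hi; rewrite updateE.
case: eqP => // Ei; move: Hi M_r; rewrite Ei; move: room; clear; lia.
Qed.

Lemma computes_const n : computes (fun _ _ => n).
Proof.
have lt_n v : n < v.+2 ^ n by apply: ltn_expl.
apply: (@computes_expr _ (Const n) n) => [v t _|M v _ t m Mn _ _]; first exact: lt_n.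
by rewrite /= modn_small //; apply: leq_trans (lt_n v) Mn.
Qed.

Lemma computes_order : computes (fun v _ => v).
Proof.
apply: (@computes_expr _ (Read (Const 0)) 1) => [v t _|M v n t m _ lay _].
  by rewrite expn1; lia.
by rewrite /= mod0n (layout_v lay).
Qed.

(** The second operand is computed into register [r.+1], which leaves the first one in register [r]
    intact. *)
Lemma computes_op o F1 F2 F k0 : computes F1 -> computes F2 ->
  (forall v t, sts_op v t -> F v t < v.+2 ^ k0) ->
  (forall M v t, sts_op v t -> v.+2 ^ k0 <= M ->
     binop_eval M o (F1 v t) (F2 v t) = F v t) ->
  computes F.
Proof.
move=> c1 c2 bF HF r r0.
have [P1 [d1 [k1 [rk1 b1 H1]]]] := c1 r r0.
have [P2 [d2 [k2 [rk2 b2 H2]]]] := c2 r.+1 isT.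
exists (Seq P1 (Seq P2 (Write (reg r) (Op o (Read (reg r)) (Read (reg r.+1)))))).
exists (d1 + d2 + 20), (k0 + k1 + k2).
have le_exp a v : a <= k0 + k1 + k2 -> v.+2 ^ a <= v.+2 ^ (k0 + k1 + k2).
  by move=> ?; rewrite leq_pexp2l.
split=> [|v t St|M v n t m St room Mk lay].
- by move: rk1; clear; lia.
- by apply: leq_trans (bF v t St) _; apply: le_exp; clear; lia.
have Mle a : a <= k0 + k1 + k2 -> v.+2 ^ a <= M.
  by move=> /(le_exp _ v) le_a; apply: leq_trans le_a Mk.
have room1 : 2 + 3 * n + v * v + k1 < M by move: room; clear; lia.
have room2 : 2 + 3 * n + v * v + k2 < M by move: room; clear; lia.
have r_M : 0 < r < M by rewrite r0; move: rk1 room1; clear; lia.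
have r1_M : 0 < r.+1 < M by move: rk2 room2; clear; lia.
apply: (@runs_seq _ _ _ _ (d1 * v.+1 ^ 4) (d2 * v.+1 ^ 4 + 20)); last first.
  have : 0 < v.+1 ^ 4 by rewrite expn_gt0.
  by clear; nia.
have le1 : v.+2 ^ k1 <= M by apply: Mle; clear; lia.
have le2 : v.+2 ^ k2 <= M by apply: Mle; clear; lia.
apply: runs_weaken (H1 M v n t m St room1 le1 lay) (leqnn _) _ => m1 [E1 fr1].
have lay1 : layout v n t m1.
  by apply: layout_frame room1 _ lay => i ik; apply: fr1; rewrite ik.
apply: runs_seq (leqnn _).
apply: runs_weaken (H2 M v n t m1 St room2 le2 lay1) (leqnn _) _ => m2 [E2 fr2].
apply: runs_write; first by rewrite /=.
have Er2 : m2 (M - r) = F1 v t.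
  by rewrite fr2 // orbC; apply/orP; left; move: r1_M; clear; lia.
have -> : eval M m2 (Op o (Read (reg r)) (Read (reg r.+1))) = F v t.
  have -> : eval M m2 (Op o (Read (reg r)) (Read (reg r.+1)))
    = binop_eval M o (m2 (eval M m2 (reg r))) (m2 (eval M m2 (reg r.+1))) by [].
  by rewrite !eval_reg // Er2 E2 HF //; apply: Mle; clear; lia.
rewrite eval_reg // updateE eqxx; split=> // i Hi; rewrite updateE.
case: eqP => [Ei|_]; first by move: Hi; rewrite Ei; move: rk1 room r_M; clear; lia.
rewrite fr2 ?fr1 //; by move: Hi r_M; clear; lia.
Qed.

Lemma computes_add F1 F2 : computes F1 -> computes F2 ->
  computes (fun v t => F1 v t + F2 v t).
Proof.
move=> c1 c2; have [k1 b1] := computes_bound c1; have [k2 b2] := computes_bound c2.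
have b v t : sts_op v t -> F1 v t + F2 v t < v.+2 ^ (k1 + k2).+1.
  move=> St; have := b1 v t St; have := b2 v t St; rewrite expnS expnD.
  have : 0 < v.+2 ^ k1 by rewrite expn_gt0.
  have : 0 < v.+2 ^ k2 by rewrite expn_gt0.
  by move: (v.+2 ^ k1) (v.+2 ^ k2) => x y; nia.
apply: (computes_op (o := OAdd) c1 c2 b) => M v t St Mk /=.
by rewrite modn_small //; apply: leq_trans (b v t St) Mk.
Qed.

Lemma computes_mul F1 F2 : computes F1 -> computes F2 ->
  computes (fun v t => F1 v t * F2 v t).
Proof.
move=> c1 c2; have [k1 b1] := computes_bound c1; have [k2 b2] := computes_bound c2.
have b v t : sts_op v t -> F1 v t * F2 v t < v.+2 ^ (k1 + k2).
  by move=> St; rewrite expnD; apply: ltn_mul; [apply: b1|apply: b2].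
apply: (computes_op (o := OMul) c1 c2 b) => M v t St Mk /=.
by rewrite modn_small //; apply: leq_trans (b v t St) Mk.
Qed.

(** Solves the additive identities for the removal of a point by one machine subtraction. *)
Lemma computes_cancel F1 F2 F : computes F1 -> computes F2 ->
  (forall v t, sts_op v t -> F v t + F2 v t = F1 v t) -> computes F.
Proof.
move=> c1 c2 E; have [k1 b1] := computes_bound c1.
have b v t : sts_op v t -> F v t < v.+2 ^ k1.
  by move=> St; apply: leq_ltn_trans (b1 v t St); rewrite -E // leq_addr.
apply: (computes_op (o := OSub) c1 c2 b) => M v t St Mk /=.
rewrite -E // addnAC addnK modnDr modn_small //.
exact: leq_trans (b v t St) Mk.
Qed.

Lemma computes_sum (I : Type) (s : seq I) (F : I -> nat -> (nat -> nat -> nat) -> nat) :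
  (forall i, computes (F i)) -> computes (fun v t => \sum_(i <- s) F i v t).
Proof.
move=> cF; elim: s => [|i s IH].
  by apply: computes_ext (computes_const 0) => v t _; rewrite big_nil.
by apply: computes_ext (computes_add (cF i) IH) => v t _; rewrite big_cons.
Qed.

(** * Programs that count embeddings *)

Section EmbeddingPrograms.
Variable T : finType.
Implicit Types (X : {set T}) (L : {set {set T}}) (e : T -> nat).

Definition inj_tests X : seq (T * T) :=
  [seq p <- enum {: T * T} | [&& p.1 \in X, p.2 \in X & p.1 != p.2]].

Definition line_tests L : seq (T * T * T) :=
  [seq p <- enum {: T * T * T} | [exists l in L,
     [&& p.1.1 \in l, p.1.2 \in l, p.2 \in l,
         p.1.1 != p.1.2, p.1.1 != p.2 & p.1.2 != p.2]]].

Lemma embedsE t X L e : embeds t X L e =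
  all (fun p => e p.1 != e p.2) (inj_tests X) &&
  all (fun p => t (e p.1.1) (e p.1.2) == e p.2) (line_tests L).
Proof.
apply/embedsP/andP => -[H1 H2]; split.
- apply/allP => -[x y]; rewrite mem_filter => /andP[/and3P[/= xX yX nxy] _].
  by apply: contraNneq nxy => /(H1 _ _ xX yX)->.
- apply/allP => -[[a b] c]; rewrite mem_filter => /andP[/exists_inP[l lL] /= H _].
  case/and5P: H => al bl cl ab /andP[ac bc].
  by apply/eqP; move/line_okP: (H2 l lL); apply.
- move=> x y xX yX; apply: contra_eq => nxy.
  by apply: (allP H1 (x, y)); rewrite mem_filter /= xX yX nxy mem_enum.
move=> l lL; apply/line_okP => a b c al bl cl ab ac bc; apply/eqP.
apply: (allP H2 (a, b, c)); rewrite mem_filter mem_enum andbT /=.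
by apply/exists_inP; exists l; rewrite // al bl cl ab ac bc.
Qed.

(** The configuration is fixed, so the whole test is one expression of constant cost. Comparing a
    truth value with 0 negates it. *)
Definition embeds_test (r : nat) X L : expr :=
  Op OMul
    (all_tests [seq Op OEq (Op OEq (Read (reg (preg r p.1))) (Read (reg (preg r p.2))))
                           (Const 0) | p : T * T <- inj_tests X])
    (all_tests [seq Op OEq (Read (table_addr (Read (reg (preg r p.1.1)))
                                             (Read (reg (preg r p.1.2)))))
                           (Read (reg (preg r p.2))) | p : T * T * T <- line_tests L]).

Lemma eval_embeds_test r X L M v n k t m e : 0 < r -> r + #|T| <= k ->
  2 + 3 * n + v * v + k < M -> triples_on X L -> layout v n t m ->
  (forall x, x \in X -> m (M - preg r x) = e x /\ e x < v) ->
  eval M m (embeds_test r X L) = embeds t X L e.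
Proof.
move=> r0 rk room XL lay He.
have M1 : 1 < M by move: room; clear; lia.
have M3 : 3 < M by move: room rk r0; clear; lia.
have small (b : bool) : b %% M = b.
  by rewrite modn_small //; case: b => //; apply: ltnW.
have rd x : x \in X -> eval M m (Read (reg (preg r x))) = e x.
  by move=> /He[<- _]; apply: eval_rpreg rk room _ _.
rewrite embedsE.
have -> : eval M m (embeds_test r X L) = (
  eval M m (all_tests [seq Op OEq (Op OEq (Read (reg (preg r p.1))) (Read (reg (preg r p.2))))
                           (Const 0) | p : T * T <- inj_tests X]) *
  eval M m (all_tests [seq Op OEq (Read (table_addr (Read (reg (preg r p.1.1)))
                                             (Read (reg (preg r p.1.2)))))
                           (Read (reg (preg r p.2))) | p : T * T * T <- line_tests L])) %% M.
  by [].
rewrite (eval_all_tests (b := fun p => e p.1 != e p.2)) //; last first.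
  move=> [x y]; rewrite mem_filter => /andP[/and3P[/= xX yX _] _].
  rewrite -[LHS]/((((eval M m (Read (reg (preg r x))) == eval M m (Read (reg (preg r y)))) %% M)
                   == 0 %% M) %% M).
  by rewrite !rd // mod0n !small eqb0.
rewrite (eval_all_tests (b := fun p => t (e p.1.1) (e p.1.2) == e p.2)) ?mulnb ?small //.
move=> [[a b] c]; rewrite mem_filter => /andP[/exists_inP[l lL] /= H _].
have [_ /subsetP lX] := XL l lL; case/and4P: H => /lX aX /lX bX /lX cX _.
have [_ la] := He a aX; have [_ lb] := He b bX.
have Eab : eval M m (table_addr (Read (reg (preg r a))) (Read (reg (preg r b))))
           = table_cell n v (e a) (e b).
  apply: eval_table_addr (layout_v lay) (layout_n lay) la lb (rd a aX) (rd b bX) => //.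
  by move: room; clear; lia.
rewrite -(layout_t lay la lb) -Eab -(rd c cX).
exact: small.
Qed.

(** A schedule with at most four free points becomes a loop nest of that depth, whose body
    increments the counter when the test succeeds. *)
Lemma computes_full X L : triples_on X L -> linear L -> #|L| <= 7 ->
  (forall x, x \in X -> 1 < #|[set l in L | x \in l]|) -> computes (embeddings X L).
Proof.
move=> XL linL L7 full r r0.
have [st [ok Est free4]] := full_generated XL linL full L7.
pose test := embeds_test r X L.
pose body := If test (Write (reg r) (Op OAdd (Read (reg r)) (Const 1))) Skip.
have [c Hc] := loops_time_bound (cost test + 12) st.
exists (Seq (Write (reg r) (Const 0)) (loops r body st)), (c + 5), (r + #|T|).
have bnd v t : embeddings X L v t < v.+2 ^ (r + #|T|).
  apply: leq_ltn_trans (isum_leq _ _ _ _) _; first by move=> e; case: embeds.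
  rewrite -cardE; apply: (@leq_ltn_trans (v.+2 ^ #|T|)); last first.
    by rewrite ltn_exp2l //; move: r0; clear; lia.
  apply: (@leq_trans (v.+2 ^ #|X|)); last by rewrite leq_pexp2l ?max_card.
  by case: #|X| => // d; rewrite leq_exp2r //; clear; lia.
split=> [|v t _|M v n t m St room Mk lay]; [exact: leq_addr|exact: bnd|].
have M1 : 1 < M by move: room; clear; lia.
have r_M : 0 < r < M by rewrite r0; move: room; clear; lia.
have V4 : 0 < v.+1 ^ 4 by rewrite expn_gt0.
apply: (@runs_seq _ _ _ _ 5 (c * v.+1 ^ 4)); last by move: V4; clear; nia.
apply: runs_write => //; rewrite eval_reg // [eval _ _ (Const 0)]/= mod0n.
set m1 := update _ _ _.
have lay1 : layout v n t m1.
  apply: layout_frame room _ lay => i ik; rewrite /m1 updateE.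
  by case: eqP => // Ei; move: ik; rewrite Ei; clear; lia.
have Ecount : scount v t st (fun e => embeds t X L e : nat) (fun _ => 0) = embeddings X L v t.
  have locP (e1 e2 : T -> nat) : {in X, e1 =1 e2} -> embeds t X L e1 = embeds t X L e2 :> nat.
    by move=> E; rewrite (embeds_local _ XL E).
  rewrite (scount_isum (L := L) (K := set0) St) //.
  - apply: isum_perm locP _ _; first exact: schedule_uniq ok.
    apply: uniq_perm; rewrite ?(schedule_uniq ok) ?enum_uniq // => x.
    by rewrite mem_enum -Est inE.
  - by move=> l /XL[].
  - by move=> e; rewrite eqb0 negbK => /embedsP[].
  - by move=> x; rewrite inE.
have m1r : m1 (M - r) = 0 by rewrite /m1 updateE eqxx.
apply: runs_weaken (@loops_run T r M v n (r + #|T|) t r0 (leqnn _) room X L body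
  (cost test + 12) (fun e => embeds t X L e : nat) st set0 (fun _ => 0) m1 St _ lay1 ok _ _ _) _ _.
- move=> m2 e lay2 He lt_M.
  have Etest := eval_embeds_test r0 (leqnn _) room XL lay2 He.
  case: (boolP (embeds t X L e)) => emb.
    rewrite emb in Etest; exists (cost test + 10).+1, (update m2 (M - r) (m2 (M - r) + 1)); split.
    + apply: ExecIfTrue; first by rewrite Etest.
      have -> : M - r = eval M m2 (reg r) by rewrite eval_reg.
      rewrite emb in lt_M.
      have -> : m2 (eval M m2 (reg r)) + 1 =
               eval M m2 (Op OAdd (Read (reg r)) (Const 1)).
        have -> : eval M m2 (Op OAdd (Read (reg r)) (Const 1))
          = (m2 (eval M m2 (reg r)) + 1 %% M) %% M by [].
        by rewrite eval_reg // (modn_small M1) modn_small.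
      exact: ExecWrite.
    + by move: (cost test) => ?; lia.
    by split=> [|i /negPf ir]; rewrite updateE ?eqxx ?ir.
  exists (cost test + 1).+1, m2; split; last by rewrite addn0.
    by apply: ExecIfFalse; [rewrite Etest (negPf emb)|constructor].
  by move: (cost test) => ?; lia.
- by rewrite set0U Est.
- by move=> x; rewrite inE.
- by rewrite m1r Ecount; apply: leq_trans (bnd v t) Mk.
- apply: leq_trans (Hc v) _; rewrite leq_mul2l leq_pexp2l ?orbT //.
move=> m' [E fr]; rewrite E m1r Ecount; split=> // i Hi.
have nir : i != M - r by apply/eqP => Ei; move: Hi r_M; rewrite Ei; clear; lia.
rewrite fr //; first by rewrite /m1 updateE (negPf nir).
move=> x _; have := preg_bound (leqnn (r + #|T|)) x; move: Hi room; clear.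
by move: (preg r x) #|T| => p q; lia.
Qed.

(** Induction on the number of points, for all systems of lines at once, because removing a point of
    degree 1 produces other configurations. These may be nonlinear, and then their count is 0. *)
Theorem computes_embeddings X L : triples_on X L -> #|L| <= 7 ->
  computes (embeddings X L).
Proof.
have [n] := ubnP #|X|; elim: n X L => // n IH X L lt_n XL L7.
pose deg x := #|[set l in L | x \in l]|.
have [/existsP[l1 /existsP[l2 /existsP[x /existsP[y]]]]|lin] :=
  boolP [exists l1, exists l2, exists x, exists y,
    [&& l1 \in L, l2 \in L, l1 != l2, x != y, x \in l1, y \in l1, x \in l2 & y \in l2]].
  case/and5P=> l1L l2L nl nxy /and4P[x1 y1 x2 y2].
  apply: computes_ext (computes_const 0) => v t _.
  by rewrite (embeddings_nonlinear v t XL l1L l2L nl nxy).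
have linL : linear L.
  move=> l1 l2 x y l1L l2L nxy x1 y1 x2 y2; apply/eqP; apply: contraNT lin => nl.
  apply/existsP; exists l1; apply/existsP; exists l2; apply/existsP; exists x.
  by apply/existsP; exists y; rewrite l1L l2L nl nxy x1 y1 x2 y2.
have smaller x : x \in X -> #|X :\ x| < n.
  by move=> xX; move: lt_n; rewrite (cardsD1 x X) xX add1n ltnS.
case: (boolP [exists x in X, deg x == 0]) => [/exists_inP[x xX]|no0].
  rewrite cards_eq0 => /eqP deg0.
  have nx l : l \in L -> x \notin l.
    by move=> lL; apply/negP => xl; move/setP/(_ l): deg0; rewrite !inE lL xl.
  have XL' : triples_on (X :\ x) L.
    by move=> l lL; have [l3 lX] := XL l lL; rewrite subsetD1 lX nx.
  have cX := IH _ _ (smaller x xX) XL' L7.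
  apply: computes_cancel (computes_mul computes_order cX)
           (computes_mul (computes_const #|X :\ x|) cX) _ => v t St.
  exact: embeddings_degree0.
case: (boolP [exists x in X, deg x == 1]) => [/exists_inP[x xX]|no1].
  move/cards1P => [l0 El0].
  have [l0L xl0] : l0 \in L /\ x \in l0.
    by have := set11 l0; rewrite -El0 inE => /andP[].
  have only l : l \in L -> x \in l -> l = l0.
    by move=> lL xl; apply/set1P; rewrite -El0 inE lL.
  have [l3 l0X] := XL _ l0L.
  have [q [r [nqr nqx nrx El]]] := card3_split l3 xl0.
  have L7' : #|L :\ l0| < 7 by move: L7; rewrite (cardsD1 l0) l0L add1n.
  have XL' : triples_on (X :\ x) (L :\ l0).
    move=> l; rewrite !inE => /andP[nl lL]; have [lc lX] := XL l lL; split=> //.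
    by rewrite subsetD1 lX /=; apply: contraNN nl => xl; rewrite (only l lL xl).
  have c0 := IH _ _ (smaller x xX) XL' (ltnW L7').
  have inX z : z \in [set q; r] -> z \in X :\ x.
    move=> zqr; have zl : z \in l0 by rewrite El inE zqr.
    rewrite !inE (subsetP l0X z zl) andbT.
    by move: zqr; rewrite !inE => /orP[]/eqP->.
  (* The default 0 extends the family to all [y], as [computes_sum] asks for every index. *)
  have cy y : computes (fun v t => if y \in X :\ x :\ q :\ r then
      embeddings (X :\ x) ([set q; r; y] |: (L :\ l0)) v t else 0).
    case: (boolP (y \in _)) => [|_]; last exact: computes_const.
    rewrite 2!in_setD1 => /and3P[nyr nyq yX]; apply: IH; first exact: smaller.
      move=> l; rewrite 2!inE => /orP[/eqP->|]; last exact: XL'.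
      split; last by rewrite !subUset !sub1set yX !inX // !inE eqxx ?orbT.
      by rewrite setUC cardsU1 cards2 nqr !inE negb_or nyq nyr.
    (* The new line replaces [l0], so there are still at most seven. *)
    by rewrite cardsU1; case: (_ \notin _); rewrite ?add1n ?add0n // ltnW.
  apply: (computes_cancel c0 (computes_sum (enum (X :\ x :\ q :\ r)) cy)) => v t St.
  rewrite El in l0L only *; rewrite -[RHS](embeddings_degree1 St XL xX nqr nqx nrx l0L only).
  by congr (_ + _); apply: eq_big_seq => y; rewrite mem_enum => ->.
apply: computes_full => // x xX.
move: no0 no1; rewrite !negb_exists => /forallP/(_ x) + /forallP/(_ x).
by rewrite xX /= -/(deg x); case: (deg x) => [|[|]].
Qed.

End EmbeddingPrograms.

(** * Occurrences and embeddings *)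

Section ThirdPoint.
Variables (v : nat) (B : {set {set 'I_v}}).
Implicit Types x y z c : 'I_v.

(** The default 0 on the diagonal agrees with the initial content of the table cells. *)
Definition third_point (a b : nat) : nat :=
  if insub a is Some x then if insub b is Some y then
    oapp (@nat_of_ord v) 0
      [pick c : 'I_v | [&& x != y, c != x, c != y & [set x; y; c] \in B]]
  else 0 else 0.

Lemma third_pointE x y : third_point x y =
  oapp (@nat_of_ord v) 0 [pick c | [&& x != y, c != x, c != y & [set x; y; c] \in B]].
Proof. by rewrite /third_point !valK. Qed.

Lemma third_point_diag x : third_point x x = 0.
Proof. by rewrite third_pointE; case: pickP => //= c; rewrite eqxx. Qed.

Lemma third_point_lt a b : a < v -> third_point a b < v.
Proof.
move=> av; have v0 : 0 < v by apply: leq_ltn_trans av.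
rewrite /third_point; case: insub => [x|] //; case: insub => [y|] //.
by case: pickP => [c _|_] /=; rewrite ?ltn_ord.
Qed.

Hypothesis STS : steiner_triple_system B.

Lemma sts_line x y : x != y ->
  exists c, [/\ c != x, c != y & [set x; y; c] \in B].
Proof.
move=> nxy; have [B3 /(_ [set x; y])] := STS; rewrite cards2 nxy => /(_ erefl).
move/eqP/cards1P => [l El].
have : l \in [set l in B | [set x; y] \subset l] by rewrite El set11.
rewrite inE subUset !sub1set => /and3P[lB xl yl].
by have [c [ncx ncy E]] := card3_split2 (B3 l lB) xl yl nxy; exists c; rewrite -E.
Qed.

Lemma sts_line_uniq x y c c' : x != y -> c != x -> c != y ->
  [set x; y; c] \in B -> [set x; y; c'] \in B -> c = c'.
Proof.
move=> nxy ncx ncy l1 l2; have [B3 /(_ [set x; y])] := STS.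
rewrite cards2 nxy => /(_ erefl)/eqP/cards1P[l El].
have inl d : [set x; y; d] \in B -> [set x; y; d] = l.
  by move=> dB; apply/set1P; rewrite -El inE dB; apply: subsetUl.
have : c \in [set x; y; c'] by rewrite (inl c' l2) -(inl c l1) !inE eqxx orbT.
by rewrite !inE (negPf ncx) (negPf ncy) /= => /eqP.
Qed.

Lemma third_pointP x y c : x != y -> c != x -> c != y ->
  (third_point x y == c) = ([set x; y; c] \in B).
Proof.
move=> nxy ncx ncy; rewrite third_pointE.
case: pickP => [d /and4P[_ ndx ndy dB]|no] /=.
  apply/eqP/idP => [/val_inj<-//|cB]; congr nat_of_ord.
  exact: sts_line_uniq nxy ndx ndy dB cB.
have [d [ndx ndy dB]] := sts_line nxy.
by have := no d; rewrite nxy ndx ndy dB.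
Qed.

Lemma sts_op_third_point : sts_op v third_point.
Proof.
have lift (Q : nat -> nat -> Prop) : (forall x y : 'I_v, Q x y) ->
    forall a b, a < v -> b < v -> Q a b.
  by move=> H a b av bv; apply: (H (Ordinal av) (Ordinal bv)).
split; apply: lift => x y.
- exact: third_point_lt.
- have [->//|nxy] := eqVneq x y; have [c [ncx ncy cB]] := sts_line nxy.
  have /eqP-> : third_point x y == c by rewrite third_pointP.
  have /eqP-> : third_point y x == c by rewrite third_pointP // ?(setUC [set y]) // eq_sym.
  by [].
- move=> nxy; have {}nxy : x != y by apply: contraNneq nxy => ->.
  have [c [ncx ncy cB]] := sts_line nxy.
  by have /eqP-> : third_point x y == c by rewrite third_pointP.
- move=> nxy; have {}nxy : x != y by apply: contraNneq nxy => ->.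
  have [c [ncx ncy cB]] := sts_line nxy.
  have /eqP-> : third_point x y == c by rewrite third_pointP.
  by apply/eqP; rewrite third_pointP // 1?setUAC // eq_sym.
Qed.

End ThirdPoint.

Section Occurrences.
Variables (T : finType) (C : {set {set T}}).
Hypothesis C3 : forall l, l \in C -> #|l| = 3.

(* The configuration on the type of its own points, so that every point lies
   on a line. *)
Definition point := {x : T | x \in cover C}.
Definition point_lines : {set {set point}} := [set val @^-1: l | l : {set T} in C].

Definition image_lines (V : finType) (f : point -> V) : {set {set V}} :=
  [set f @: l | l : {set point} in point_lines].

Definition automorphisms : nat :=
  #|[set g : {ffun point -> point} | injectiveb g & image_lines g == point_lines]|.

Lemma val_preim_line l : l \in C -> (val : point -> T) @: (val @^-1: l) = l.
Proof.
move=> lC; apply/setP => x; apply/imsetP/idP => [[u ul ->]|xl].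
  by rewrite inE in ul.
have xc : x \in cover C by apply/bigcupP; exists l.
by exists (exist _ x xc); rewrite ?inE.
Qed.

Lemma card_point_line l : l \in point_lines -> #|l| = 3.
Proof.
by case/imsetP=> l0 l0C ->; rewrite -(card_imset _ val_inj) val_preim_line ?C3.
Qed.

Lemma point_on_line (u : point) : exists2 l, l \in point_lines & u \in l.
Proof.
have /bigcupP[l lC ul] := valP u; exists (val @^-1: l); last by rewrite inE.
exact: imset_f.
Qed.

Lemma image_lines_val (V : finType) (f : T -> V) :
  image_lines (fun u => f (val u)) = [set [set f x | x in l] | l : {set T} in C].
Proof.
rewrite /image_lines /point_lines -imset_comp; apply: eq_in_imset => l lC /=.
by rewrite -{2}(val_preim_line lC) -imset_comp.
Qed.

Lemma eq_image_lines (V : finType) (f g : point -> V) :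
  f =1 g -> image_lines f = image_lines g.
Proof. by move=> E; apply: eq_imset => l; apply: eq_imset. Qed.

(** Isomorphisms matter only on the points of [C]. Extending one to all of [T] takes a default
    point, which exists because [C] has a line. *)
Lemma config_isoE (V : finType) (D : {set {set V}}) : C != set0 ->
  config_iso C D = [exists f : {ffun point -> V}, injectiveb f && (image_lines f == D)].
Proof.
move=> C0; apply/existsP/existsP => -[f /andP[inj /eqP E]].
  exists [ffun u => f (val u)]; apply/andP; split.
    apply/injectiveP => u w; rewrite !ffunE => Euw; apply/val_inj/eqP.
    have /forall_inP/(_ _ (valP u))/forall_inP/(_ _ (valP w)) := inj.
    by rewrite Euw eqxx.
  by rewrite -E -image_lines_val; apply/eqP/eq_image_lines => u; rewrite ffunE.
have [u0 _] : exists u : point, true.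
  have /set0Pn[l lC] := C0; have /card_gt0P[x xl] : 0 < #|l| by rewrite C3.
  have xc : x \in cover C by apply/bigcupP; exists l.
  by exists (exist _ x xc).
pose h x := f (insubd u0 x); exists [ffun x => h x].
have hval (u : point) : [ffun x => h x] (val u) = f u by rewrite ffunE /h valKd.
apply/andP; split.
  apply/forall_inP => x xc; apply/forall_inP => y yc; apply/implyP.
  rewrite !ffunE /h => /eqP/(injectiveP _ inj) Exy.
  by have := congr1 val Exy; rewrite !val_insubd xc yc => /eqP.
rewrite -(image_lines_val [ffun x => h x]) -E; apply/eqP/eq_image_lines => u.
exact: hval.
Qed.

(** Every isomorphism onto [D] is the fixed one [f0] preceded by a unique automorphism. *)
Lemma card_isos (V : finType) (D : {set {set V}}) (f0 : {ffun point -> V}) :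
  injective f0 -> image_lines f0 = D ->
  #|[set f : {ffun point -> V} | injectiveb f & image_lines f == D]| = automorphisms.
Proof.
move=> inj0 E0.
pose comp (g : {ffun point -> point}) : {ffun point -> V} := [ffun u => f0 (g u)].
have comp_inj : injective comp.
  move=> g h /ffunP E; apply/ffunP => u; have := E u; rewrite !ffunE.
  exact: inj0.
have image_comp g : image_lines (comp g) = [set f0 @: l | l : {set point} in image_lines g].
  rewrite /image_lines -[RHS]imset_comp; apply: eq_imset => l /=.
  by rewrite -[RHS](imset_comp f0 g); apply: eq_imset => u; rewrite ffunE.
rewrite /automorphisms -(card_imset _ comp_inj); apply: eq_card => f.
rewrite [in LHS]inE; apply/andP/imsetP => [[/injectiveP inj /eqP E]|[g]].
  (* Every point is on a line, and [f] and [f0] have the same image lines, so values of [f] are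
     values of [f0]. *)
  have ex u : exists w, f0 w == f u.
    have [l lL ul] := point_on_line u.
    have : f @: l \in image_lines f0 by rewrite E0 -E; apply: imset_f.
    case/imsetP => l' _ El; have : f u \in f0 @: l' by rewrite -El imset_f.
    by case/imsetP => w _ Ew; exists w; rewrite Ew.
  pose g := [ffun u => xchoose (ex u)].
  have gE u : f0 (g u) = f u by rewrite ffunE; apply/eqP; apply: (xchooseP (ex u)).
  have fE : f = comp g by apply/ffunP => u; rewrite ffunE gE.
  exists g => //; rewrite inE; apply/andP; split.
    by apply/injectiveP => u w Euw; apply: inj; rewrite -!gE Euw.
  apply/eqP; apply: (imset_inj (imset_inj inj0)).
  by rewrite -image_comp -fE E -E0.
rewrite inE => /andP[/injectiveP injg /eqP Eg] ->; split.
  by apply/injectiveP => u w; rewrite !ffunE => /inj0/injg.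
by rewrite image_comp Eg; apply/eqP.
Qed.

Lemma automorphisms_gt0 : 0 < automorphisms.
Proof.
apply/card_gt0P; exists [ffun u => u]; rewrite inE; apply/andP; split.
  by apply/injectiveP => u w; rewrite !ffunE.
apply/eqP; rewrite -[RHS]imset_id; apply: eq_imset => l.
by rewrite -[RHS]imset_id; apply: eq_imset => u; rewrite ffunE.
Qed.

Lemma embeds_third_point v (B : {set {set 'I_v}}) (f : {ffun point -> 'I_v}) :
  steiner_triple_system B ->
  embeds (third_point B) [set: point] point_lines (fun u => f u) =
  injectiveb f && (image_lines f \subset B).
Proof.
move=> STS; have St := sts_op_third_point STS.
case: (boolP (injectiveb f)) => [/injectiveP inj|ninj] /=; last first.
  apply/negP => /embedsP[inj _]; case/negP: ninj; apply/injectiveP => u w E.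
  by apply: inj; rewrite ?inE ?E.
have lineE l : l \in point_lines -> line_ok (third_point B) (fun u => f u) l = (f @: l \in B).
  move=> lL; have l3 := card_point_line lL; have /card_gt0P[x xl] : 0 < #|l| by rewrite l3.
  have [q [r [nqr nqx nrx ->]]] := card3_split l3 xl.
  have nf a b : a != b -> f a != f b by apply: contraNneq => /inj->.
  have nf' a b : a != b -> f a != f b :> nat by move=> /nf.
  rewrite (line_ok3 St) ?nf' // (third_pointP STS) ?nf // 1?eq_sym //.
  by rewrite !imsetU !imset_set1.
apply/embedsP/subsetP => [[_ ok] _ /imsetP[l lL ->]|sub].
  by rewrite -lineE ?ok.
split=> [u w _ _ E|l lL]; first by apply/inj/val_inj.
by rewrite lineE // sub // imset_f.
Qed.

(** Embeddings are grouped by their image lines; each occurrence is the image of as many embeddings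
    as there are automorphisms. *)
Lemma embeddings_occurrences v (B : {set {set 'I_v}}) :
  steiner_triple_system B -> C != set0 ->
  embeddings [set: point] point_lines v (third_point B) =
  occurrences C B * automorphisms.
Proof.
move=> STS C0; rewrite /embeddings isum_ffun; first last.
- by move=> y; rewrite mem_enum inE.
- exact: enum_uniq.
- move=> e1 e2 E; congr nat_of_bool; apply: embeds_local => [l lL|u _]; last exact: E.
  by rewrite subsetT card_point_line.
rewrite (eq_bigl xpredT) => [|f]; last first.
  by apply/forallP => y; rewrite mem_enum inE.
under eq_bigr => f _ do rewrite embeds_third_point //.
pose occ := [set D : {set {set 'I_v}} | (D \subset B) && config_iso C D].
rewrite -sum_nat_const -(eq_bigr _ (F1 := fun D =>
  \sum_(f : {ffun point -> 'I_v}) (injectiveb f && (image_lines f == D)))); last first.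
  move=> D; rewrite inE => /andP[_]; rewrite config_isoE // => /existsP[f0].
  case/andP=> /injectiveP inj0 /eqP E0; rewrite -(card_isos inj0 E0) -sum1_card.
  by rewrite [RHS]big_mkcond; apply: eq_bigr => f _; rewrite inE; case: (_ && _).
(* After the exchange, an embedding contributes only at its own image. *)
rewrite exchange_big; apply: eq_bigr => f _ /=.
case: (boolP (injectiveb f)) => inj /=; last by rewrite big1.
case: (boolP (image_lines f \subset B)) => sub.
  rewrite (bigD1 (image_lines f)) /=; last first.
    by rewrite inE sub config_isoE //; apply/existsP; exists f; rewrite inj eqxx.
  by rewrite eqxx big1 // => D /andP[_]; rewrite eq_sym => /negPf->.
rewrite big1 // => D; rewrite inE => /andP[DB _].
by case: eqP => // E; rewrite E DB in sub.
Qed.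

End Occurrences.

(** * Tabulating the third point of every line *)

Section Tabulation.

(** Register 1 holds the index of the current line; the offset 2 skips the two header words of the
    input. *)
Definition line_point (j : nat) : expr :=
  Read (Op OAdd (Const (2 + j)) (Op OMul (Const 3) (Read (reg 1)))).

Definition stores (ws : seq (nat * nat * nat)) : cmd :=
  foldr (fun w => Seq (Write (table_addr (line_point w.1.1) (line_point w.1.2))
                             (line_point w.2))) Skip ws.

Definition line_orders : seq (nat * nat * nat) :=
  [:: (0, 1, 2); (1, 0, 2); (0, 2, 1); (2, 0, 1); (1, 2, 0); (2, 1, 0)].

Definition tabulate : cmd :=
  Seq (Write (reg 1) (Const 0))
      (While (Op OLt (Read (reg 1)) (Read (Const 1)))
             (Seq (stores line_orders)
                  (Write (reg 1) (Op OAdd (Read (reg 1)) (Const 1))))).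

Variables (M v n : nat) (t : nat -> nat -> nat).
Hypothesis room : 2 + 3 * n + v * v + 10 < M.

Lemma eval_line_point m i j : i < n -> j < 3 -> m (M - 1) = i ->
  eval M m (line_point j) = m (2 + 3 * i + j).
Proof.
move=> iN j3 mi.
have -> : eval M m (line_point j) =
  m (((2 + j) %% M + (3 %% M * m (eval M m (reg 1))) %% M) %% M) by [].
rewrite eval_reg; last by move: room; clear; lia.
rewrite mi !modn_small; first by congr (m _); lia.
all: rewrite ?modn_small; move: room iN j3; clear; lia.
Qed.

(** The stores go above the input, so later reads of the line are unaffected. *)
Lemma stores_run ws (p : nat -> nat) i m :
  i < n -> m 0 = v -> m 1 = n -> m (M - 1) = i ->
  (forall j, j < 3 -> m (2 + 3 * i + j) = p j /\ p j < v) ->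
  (forall w, w \in ws -> [&& w.1.1 < 3, w.1.2 < 3, w.2 < 3 &
     t (p w.1.1) (p w.1.2) == p w.2]) ->
  runs M (stores ws) m (60 * size ws + 1) (fun m' =>
    [/\ forall j, j < 2 + 3 * n -> m' j = m j, m' (M - 1) = i &
        forall a b, a < v -> b < v -> m' (table_cell n v a b) =
          if (a, b) \in [seq (p w.1.1, p w.1.2) | w : nat * nat * nat <- ws]
          then t a b else m (table_cell n v a b)]).
Proof.
move=> iN; elim: ws m => [|[[x y] z] ws IH] m m0 m1 mi mp Hw /=.
  by exists 1, m; split=> //; constructor.
have /and4P[/= x3 y3 z3 /eqP Et] := Hw _ (mem_head _ _).
have [Ex lx] := mp x x3; have [Ey ly] := mp y y3; have [Ez lz] := mp z z3.
apply: (@runs_seq _ _ _ _ 60 (60 * size ws + 1)); last by move: (size ws); clear; lia.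
apply: runs_write => //.
have -> : eval M m (table_addr (line_point x) (line_point y)) = table_cell n v (p x) (p y).
  apply: eval_table_addr m0 m1 lx ly _ _; try by move: room; clear; lia.
    by rewrite (eval_line_point iN) // Ex.
  by rewrite (eval_line_point iN) // Ey.
rewrite (eval_line_point iN) // Ez -Et.
set m2 := update _ _ _.
have low j : j < 2 + 3 * n -> m2 j = m j.
  move=> jn; rewrite /m2 updateE; case: eqP => // E; move: jn; rewrite E /table_cell.
  by clear; lia.
have m2i : m2 (M - 1) = i.
  rewrite /m2 updateE; case: eqP => // E; have := table_cell_lt n lx ly.
  by rewrite -E; move: room; clear; lia.
apply: runs_weaken (IH m2 _ _ m2i _ _) (leqnn _) _.
- by rewrite low.
- by rewrite low.
- by move=> j j3; rewrite low; [apply: mp|move: iN j3; clear; lia].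
- by move=> w wws; apply: Hw; rewrite inE wws orbT.
move=> m' [low' m'i tab]; split=> // [j jn|a b av bv]; first by rewrite low' ?low.
rewrite tab // inE; case: (_ \in map _ _); rewrite ?orbT // orbF /m2 updateE; case: eqP => [/(table_cell_inj bv ly)[-> ->]|ne].
  by rewrite eqxx.
by case: eqP => // -[Ea Eb]; case: ne; rewrite Ea Eb.
Qed.

Definition on_row (a b : nat) (w : seq nat) : bool :=
  [&& a != b, a \in w & b \in w].

Lemma line_orders_mem (p : nat -> nat) a b :
  uniq [:: p 0; p 1; p 2] ->
  ((a, b) \in [seq (p w.1.1, p w.1.2) | w : nat * nat * nat <- line_orders]) =
  on_row a b [:: p 0; p 1; p 2].
Proof.
rewrite /= !inE /on_row !inE !xpair_eqE negb_or => /and3P[/andP[n01 n02] n12 _].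
have [->|na0] := eqVneq a (p 0).
  rewrite (negPf n01) (negPf n02) /= orbF [p 0 == b]eq_sym.
  by have [->|_] := eqVneq b (p 0); rewrite ?(negPf n01) ?(negPf n02).
have [->|na1] := eqVneq a (p 1).
  rewrite (negPf n12) /= [p 1 == b]eq_sym ?orbF.
  by have [->|_] := eqVneq b (p 1); rewrite ?(negPf n12) ?orbF // eq_sym (negPf n01).
rewrite /=; have [->|na2] := eqVneq a (p 2); last by rewrite andbF.
rewrite /= [p 2 == b]eq_sym.
by have [->|_] := eqVneq b (p 2); rewrite ?orbF // ![p 2 == _]eq_sym (negPf n02) (negPf n12).
Qed.

(** Any two distinct points are on a listed line, so every entry off the diagonal gets written; on
    the diagonal the initial 0 is already right. *)
Lemma tabulate_run (W : seq (seq nat)) m : size W = n -> n <= v ^ 3 ->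
  m 0 = v -> m 1 = n ->
  (forall i j, i < n -> j < 3 -> m (2 + 3 * i + j) = nth 0 (nth [::] W i) j) ->
  (forall a b, a < v -> b < v -> m (table_cell n v a b) = 0) ->
  (forall w, w \in W -> [/\ size w = 3, uniq w, forall a, a \in w -> a < v &
     forall w', w' \in line_orders ->
       t (nth 0 w w'.1.1) (nth 0 w w'.1.2) = nth 0 w w'.2]) ->
  (forall a b, a < v -> b < v -> a != b -> has (on_row a b) W) ->
  (forall a, a < v -> t a a = 0) ->
  runs M tabulate m (500 * v.+1 ^ 4) (layout v n t).
Proof.
move=> sW n3 m0 m1 mW mtab HW allW diag.
have M1 : 0 < 1 < M by move: room; clear; lia.
apply: (@runs_seq _ _ _ _ 5 (n * (371 + 8) + 8)); last first.
  have : v ^ 3 <= v.+1 ^ 3 by rewrite leq_exp2r.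
  have : 0 < v.+1 ^ 3 by rewrite expn_gt0.
  rewrite (expnS v.+1 3); move: n3; move: (v ^ 3) (v.+1 ^ 3); clear; nia.
apply: runs_write => //; rewrite eval_reg // [eval _ _ (Const 0)]/= mod0n.
set m' := update _ _ _.
(* After [i] rounds the input is intact and the table is filled for the pairs on the first [i] lines
   and 0 elsewhere. *)
pose I i m2 := [/\ m2 (M - 1) = i, forall j, j < 2 + 3 * n -> m2 j = m j &
  forall a b, a < v -> b < v -> m2 (table_cell n v a b) =
     if has (on_row a b) (take i W) then t a b else 0].
have I0 : I 0 m'.
  split=> [|j jn|a b av bv]; rewrite /m' updateE ?eqxx //.
    by case: eqP => // E; move: jn room; rewrite E; clear; lia.
  rewrite take0 /=; case: eqP => [E|_]; last exact: mtab.
  by have := table_cell_lt n av bv; rewrite E; move: room; clear; lia.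
have cond i m2 : I i m2 ->
    eval M m2 (Op OLt (Read (reg 1)) (Read (Const 1))) = (i < n).
  case=> Ei low _.
  have -> : eval M m2 (Op OLt (Read (reg 1)) (Read (Const 1)))
    = (m2 (eval M m2 (reg 1)) < m2 (1 %% M)) %% M by [].
  rewrite eval_reg // (modn_small (m := 1)); last by move: room; clear; lia.
  rewrite Ei low // m1 modn_small //.
  by case: (i < n); move: room; clear; lia.
apply: runs_weaken (runs_while (I := I) (N := n) (tc := 371) _ _ I0) (leqnn _) _.
- move=> i m2 iN Ii; rewrite (cond _ _ Ii) iN; split=> //; have [Ei low tab] := Ii.
  have iW : i < size W by rewrite sW.
  have [sw uw ltw tw] := HW _ (mem_nth [::] iW).
  pose p j := nth 0 (nth [::] W i) j.
  have Ew : nth [::] W i = [:: p 0; p 1; p 2].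
    apply: (@eq_from_nth _ 0) => // j; rewrite sw => j3.
    by case: j j3 => [|[|[|]]].
  apply: (@runs_seq _ _ _ _ 361 10) => //.
  apply: runs_weaken (@stores_run line_orders p i m2 iN _ _ Ei _ _) (leqnn _) _.
  + by rewrite low.
  + by rewrite low.
  + move=> j j3; rewrite low; last by move: iN j3; clear; lia.
    by rewrite mW //; split=> //; apply: ltw; rewrite mem_nth ?sw.
  + move=> w wl; rewrite /p tw // eqxx andbT.
    have /allP/(_ w wl) // : all (fun w => [&& w.1.1 < 3, w.1.2 < 3 & w.2 < 3]) line_orders.
    by [].
  move=> m3 [low3 m3i tab3]; apply: runs_write => //.
  have -> : eval M m3 (Op OAdd (Read (reg 1)) (Const 1)) = i.+1.
    have -> : eval M m3 (Op OAdd (Read (reg 1)) (Const 1))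
      = (m3 (eval M m3 (reg 1)) + 1 %% M) %% M by [].
    by rewrite eval_reg // m3i !modn_small; move: room iN; clear; lia.
  rewrite eval_reg //; split=> [|j jn|a b av bv]; rewrite updateE ?eqxx //.
    by case: eqP => [E|_]; [move: jn room; rewrite E; clear; lia|rewrite low3 ?low].
  case: eqP => [E|_].
    by have := table_cell_lt n av bv; rewrite E; move: room; clear; lia.
  rewrite tab3 // tab // (take_nth [::] iW) has_rcons Ew.
  by rewrite line_orders_mem -?Ew //; case: (on_row a b _).
- by move=> m2 Ii; rewrite (cond _ _ Ii) ltnn.
move=> m2 [_ low tab]; split; rewrite ?low // => a b av bv.
rewrite tab // -sW take_size; have [->|nab] := eqVneq a b.
  by rewrite diag // if_same.
by rewrite allW.
Qed.

End Tabulation.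

(** * Tabulation from the actual input *)

Lemma nth_input_line (A : Type) (f g h : A -> nat) (s : seq A) i j :
  i < size s -> j < 3 ->
  nth 0 (flatten [seq [:: f x; g x; h x] | x <- s]) (3 * i + j) =
  nth 0 (nth [::] [seq [:: f x; g x; h x] | x <- s] i) j.
Proof.
elim: s i => [|x s IH] [|i] // iS j3; first by case: j {IH} j3 => [|[|[|]]].
rewrite (_ : 3 * i.+1 + j = (3 * i + j).+3); last by lia.
exact: IH.
Qed.

Lemma size_input_words v (s : seq ('I_v * 'I_v * 'I_v)) :
  size (input_words s) = 2 + 3 * size s.
Proof.
rewrite /input_words /= size_flatten /shape -map_comp.
by elim: s => //= x s; lia.
Qed.

Lemma card_sts v (B : {set {set 'I_v}}) : steiner_triple_system B -> #|B| <= v ^ 3.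
Proof.
case=> B3 _.
have sub : B \subset [set [set p.1.1; p.1.2; p.2] | p : 'I_v * 'I_v * 'I_v].
  apply/subsetP => l lB; have l3 := B3 l lB.
  have /card_gt0P[x xl] : 0 < #|l| by rewrite l3.
  have [q [r [_ _ _ ->]]] := card3_split l3 xl.
  by apply/imsetP; exists (q, r, x).
apply: leq_trans (subset_leq_card sub) _; apply: leq_trans (leq_imset_card _ _) _.
by rewrite !card_prod !card_ord !expnS expn0 muln1 mulnA.
Qed.

Lemma tabulate_input v (B : {set {set 'I_v}}) (s : seq ('I_v * 'I_v * 'I_v)) M :
  steiner_triple_system B -> lists_lines s B ->
  2 + 3 * size s + v * v + 10 < M ->
  runs M tabulate (initial_memory M (input_words s)) (500 * v.+1 ^ 4)
       (layout v (size s) (third_point B)).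
Proof.
move=> STS sB room; have [B3 _] := STS.
pose W := [seq [:: nat_of_ord p.1.1; nat_of_ord p.1.2; nat_of_ord p.2] | p <- s].
have v_M : v < M by move: room; clear; nia.
have sB' p : p \in s -> [set p.1.1; p.1.2; p.2] \in B.
  by move=> ps; rewrite -mem_enum -(perm_mem sB); apply/mapP; exists p.
have rowP w : w \in W -> exists x y z : 'I_v, [/\ w = [:: nat_of_ord x; nat_of_ord y; nat_of_ord z],
    [set x; y; z] \in B, x != y, x != z & y != z].
  case/mapP=> -[[x y] z] /sB' /= lB ->; exists x, y, z.
  by have [] := card3_neq (B3 _ lB).
apply: (@tabulate_run _ _ _ _ room W) => //.
- by rewrite size_map.
- have := perm_size sB; rewrite size_map -cardE => ->; exact: card_sts.
- by rewrite /initial_memory /= modn_small.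
- by rewrite /initial_memory /= modn_small //; move: room; clear; lia.
- move=> i j iS j3; rewrite /initial_memory -addnA.
  rewrite -[nth 0 _ _]/(nth 0 (flatten W) (3 * i + j)) nth_input_line //.
  have iW : i < size W by rewrite size_map.
  have [x [y [z [-> _ _ _ _]]]] := rowP _ (mem_nth [::] iW).
  have small (u : 'I_v) : u %% M = u by rewrite modn_small // (ltn_trans (ltn_ord u)).
  by case: j j3 => [|[|[|]]] //= _; rewrite small.
(* The table starts right after the input, where memory is 0 by default. *)
- move=> a b _ _; rewrite /initial_memory nth_default ?mod0n // size_input_words.
  exact: leq_addr.
- move=> w /rowP[x [y [z [-> lB nxy nxz nyz]]]].
  have nat_neq (a b : 'I_v) : a != b -> (a : nat) == b = false by move=> /negPf.
  have T1 (a b c : 'I_v) : a != b -> a != c -> b != c -> [set a; b; c] = [set x; y; z] ->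
      third_point B a b = c.
    by move=> ab ac bc E; apply/eqP; rewrite (third_pointP STS) ?E // eq_sym.
  split=> //.
  + by rewrite /= !inE !nat_neq.
  + by move=> a; rewrite !inE => /or3P[]/eqP->.
  move=> w'; rewrite !inE => /or4P[|||/or3P[]] /eqP-> /=; apply: T1; rewrite // 1?eq_sym //.
  + by rewrite (setUC [set y]).
  + by rewrite setUAC.
  + by rewrite -setUA setUC.
  + by rewrite setUC setUA.
  + by rewrite setUC (setUC [set z]) setUA.
- move=> a b av bv nab; pose x := Ordinal av; pose y := Ordinal bv.
  have [c [_ _ lB]] := sts_line STS (nab : x != y).
  move: lB; rewrite -mem_enum -(perm_mem sB) => /mapP[p ps E].
  apply/hasP; exists [:: nat_of_ord p.1.1; nat_of_ord p.1.2; nat_of_ord p.2].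
    by apply/mapP; exists p.
  have xl : x \in [set p.1.1; p.1.2; p.2] by rewrite -E !inE eqxx.
  have yl : y \in [set p.1.1; p.1.2; p.2] by rewrite -E !inE eqxx orbT.
  by rewrite /on_row nab !inE -!orbA in xl yl *; rewrite xl yl.
- by move=> a av; apply: (third_point_diag B (Ordinal av)).
Qed.

(** * Word size *)

Lemma leq_word_modulus k v : v.+2 ^ k <= word_modulus k v.
Proof.
rewrite /word_modulus mulnC expnM; case: k => // k.
by rewrite leq_exp2r //; apply: up_logP.
Qed.

(** Of [v.+2 ^ (k + 6)], the factor [v.+2 ^ k] exceeds [k], one cube bounds [n] and [v * v], and the
    other is at least 8 and absorbs the constants. *)
Lemma word_modulus_room k v n : n <= v ^ 3 ->
  2 + 3 * n + v * v + k < word_modulus (k + 6) v.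
Proof.
move=> n3; apply: leq_trans (leq_word_modulus _ _).
have lt_k : k < v.+2 ^ k by apply: ltn_expl.
apply: (@leq_trans (v.+2 ^ k * v.+2 ^ 6)); last by rewrite -expnD.
have le3 : v ^ 3 <= v.+2 ^ 3 by rewrite leq_exp2r //; lia.
have -> : v.+2 ^ 6 = v.+2 ^ 3 * v.+2 ^ 3 by rewrite -expnD.
have h8 : 8 <= v.+2 ^ 3 by rewrite -[8]/(2 ^ 3) leq_exp2r.
have hv : v * v <= v.+2 ^ 3 by rewrite !expnS expn0 muln1; clear; nia.
move: lt_k le3 h8 hv n3; move: (v.+2 ^ k) (v.+2 ^ 3) (v ^ 3) (v * v) => a b c d.
move=> ka cb b8 db nc.
have h1 : 8 * (a * b) <= a * (b * b) by rewrite [leqRHS]mulnA [leqRHS]mulnC leq_mul2r b8 orbT.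
have h2 : a + b <= a * b + 1 by clear - ka b8; nia.
have h3 : b <= a * b by rewrite leq_pmull //; apply: leq_ltn_trans ka.
by apply: leq_trans h1; move: ka cb b8 db nc h2 h3; move: (a * b) => e; clear; lia.
Qed.

(** * Computing the number of occurrences *)

Theorem theorem6 (T : finType) (B C : {set {set T}})
    (hB : steiner_triple_system B) (hCB : C \subset B)
    (hC : #|C| = 6 \/ #|C| = 7) (hvar : variable_config C) :
  sts_computable_in_time_O
    (fun (v : nat) (S : {set {set 'I_v}}) => occurrences C S)
    (fun v : nat => v ^ 4).
Proof.
have C3 l : l \in C -> #|l| = 3 by move=> /(subsetP hCB); case: hB => B3 _; apply: B3.
have C7 : #|C| <= 7 by case: hC => ->.
have C0 : C != set0 by rewrite -card_gt0; case: hC => ->.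
have PL : triples_on [set: point C] (point_lines C).
  by move=> l lL; rewrite subsetT (card_point_line C3 lL).
have L7 : #|point_lines C| <= 7 by apply: leq_trans (leq_imset_card _ _) C7.
have [P [c [k [k1 bnd HP]]]] := computes_embeddings PL L7 (isT : 0 < 1).
pose A := automorphisms C.
(* Tabulate third points, count embeddings into register 1, divide by the number of
   automorphisms. *)
exists (Seq tabulate (Seq P (Write (Const 0) (Op ODiv (Read (reg 1)) (Const A))))).
(* [k] serves the counting program, 10 the tabulation, [A] makes the divisor fit in a word, and 6
   leaves room for input and table. *)
pose K := k + 10 + A; exists (K + 6), (16 * (500 + c + 10)), 1.
move=> v S s STS sS; set M := word_modulus _ _.
have n3 : size s <= v ^ 3.
  by have := perm_size sS; rewrite size_map -cardE => ->; apply: card_sts.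
have room : 2 + 3 * size s + v * v + K < M by apply: word_modulus_room.
have Mk : v.+2 ^ k <= M.
  apply: leq_trans (leq_word_modulus _ _); rewrite leq_pexp2l // /K; clear; lia.
have AM : A < M by move: room; rewrite /K; clear; lia.
have M1 : 0 < 1 < M by move: room; clear; lia.
have St := sts_op_third_point STS.
have Eocc := embeddings_occurrences C3 STS C0.
suff [u [m [x le_u E]]] : runs M
    (Seq tabulate (Seq P (Write (Const 0) (Op ODiv (Read (reg 1)) (Const A)))))
    (initial_memory M (input_words s)) ((500 + c + 10) * v.+1 ^ 4)
    (fun m => m 0 = occurrences C S).
  exists u, m; split=> // v1; apply: leq_trans le_u _.
  rewrite -mulnA mulnCA leq_mul2l; apply/orP; right.
  (* For [1 <= v], [v.+1 <= 2 * v]; this is the origin of the factor 16. *)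
  by rewrite -[16]/(2 ^ 4) -expnMn leq_exp2r //; move: v1; clear; lia.
apply: (@runs_seq _ _ _ _ (500 * v.+1 ^ 4) (c * v.+1 ^ 4 + 10)); last first.
  have : 0 < v.+1 ^ 4 by rewrite expn_gt0.
  by move: (v.+1 ^ 4); clear; nia.
apply: runs_weaken (tabulate_input STS sS _) (leqnn _) _.
  by move: room; rewrite /K; clear; lia.
move=> m1 lay1; apply: runs_seq (leqnn _).
apply: runs_weaken (HP M v (size s) _ m1 St _ Mk lay1) (leqnn _) _.
  by move: room; rewrite /K; clear; lia.
move=> m2 [E2 _]; apply: runs_write => //.
have -> : eval M m2 (Const 0) = 0 by rewrite /= mod0n.
have -> : eval M m2 (Op ODiv (Read (reg 1)) (Const A)) =
  (m2 (eval M m2 (reg 1)) %/ (A %% M)) %% M by [].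
(* The division is exact, and the quotient is at most the number of embeddings, which fits in a
   word. *)
rewrite eval_reg // E2 Eocc (modn_small AM) mulnK ?automorphisms_gt0 //.
rewrite updateE eqxx modn_small //; apply: leq_trans Mk.
apply: leq_ltn_trans (bnd v _ St); rewrite Eocc leq_pmulr //.
exact: automorphisms_gt0.
Qed.
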